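(* Let $B$ be a finite connected CW left regular band and $\Bbbk$ a field. If $\Bbbk B$ is isomorphic to the incidence algebra of a poset, then $\Lambda(B)$ is thin, i.e., every interval of rank $2$ in $\Lambda(B)$ has exactly four elements.
   Context: A left regular band is a finite semigroup $B$ with $x^2=x$, $xyx=xy$, ordered by $a\le b$ iff $ba=a$; $\Lambda(B)=\{Bb\}$ ordered by inclusion (a graded poset when $B$ is a CW left regular band); $B_{\ge X}=\{b\mid Bb\supseteq X\}$; $B$ is connected if each order complex $\Delta(B_{\ge X})$ is connected. A CW poset is a finite graded poset such that the realization of $\Delta(P_{<p})$ is a sphere of dimension $\dim\Delta(P_{\le p})-1$; $B$ is a CW left regular band if every $B_{\ge X}$ is a CW poset. The incidence algebra $I(P;\Bbbk)$ has basis the pairs $(\sigma,\tau)$ with $\sigma\le\tau$ and product $(\sigma,\tau)(\alpha,\beta)=(\alpha,\tau)$ if $\beta=\sigma$ and $0$ otherwise. *)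

(* Defs.v *)
From HB Require Import structures.
From mathcomp Require Import all_boot all_order all_algebra.
From mathcomp Require Import all_classical all_reals all_analysis.

Set Implicit Arguments.
Unset Strict Implicit.
Unset Printing Implicit Defensive.

Import Order.TTheory GRing.Theory Num.Theory.
Import numFieldNormedType.Exports.
Export Order.DefaultSetSubsetOrder.

Local Open Scope ring_scope.

(** * Order complexes and geometric realizations *)

Section OrderComplex.
Context {d : Order.disp_t} {T : finPOrderType d}.
Implicit Types (A s : {set T}) (x y p : T).

(* A subset [A] of [T] stands for the induced subposet on [A]. *)

Definition is_chain s : bool :=
  [forall x in s, [forall y in s, (x >=< y)%O]].

(* As an abstract simplicial complex, the faces being nonempty. *)
Definition order_complex A : {set {set T}} :=
  [set s : {set T} | [&& s \subset A, s != finset.set0 & is_chain s]]%SET.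

Definition below A p : {set T} := [set x in A | (x <= p)%O]%SET.
Definition strictly_below A p : {set T} := [set x in A | (x < p)%O]%SET.
Definition order_interval A x y : {set T} := [set z in A | (x <= z <= y)%O]%SET.

Definition graded A : Prop :=
  forall p, p \in A -> forall s1 s2 : {set T},
    maxset (mem (order_complex (below A p))) s1 ->
    maxset (mem (order_complex (below A p))) s2 -> #|s1| = #|s2|.

End OrderComplex.

(* The truncated predecessor gives 0 instead of -1 on the empty complex. *)
Definition complex_dim (V : finType) (K : {set {set V}}) : nat :=
  (\max_(s in K) #|s|).-1.

Definition realization (R : realType) (V : finType) (K : {set {set V}}) :
    set {ptws V -> R} :=
  [set x | [/\ forall v, 0 <= x v, \sum_v x v = 1
             & [set v | x v != 0]%SET \in K]]%classic.
Arguments realization R {V} K.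

(* The unit sphere of R^m, of dimension [m - 1]; it is empty when [m = 0]. *)
Definition unit_sphere (R : realType) (m : nat) : set 'rV[R]_m :=
  [set u : 'rV[R]_m | \sum_(i < m) u ord0 i ^+ 2 = 1]%classic.
Arguments unit_sphere : clear implicits.

Definition homeomorphic (U V : topologicalType) (A : set U) (C : set V) :
    Prop :=
  exists (f : U -> V) (g : V -> U),
    [/\ {within A, continuous f}%classic /\ (forall u, A u -> C (f u)),
        {within C, continuous g}%classic /\ (forall v, C v -> A (g v)),
        forall u, A u -> g (f u) = u
      & forall v, C v -> f (g v) = v].

(* With [m] the dimension of [order_complex (below A p)], the sphere of
   dimension [m - 1] is [unit_sphere R m]. *)
Definition CW_poset (R : realType) (d : Order.disp_t) (T : finPOrderType d)
    (A : {set T}) : Prop :=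
  graded A /\
  forall p, p \in A ->
    homeomorphic (realization R (order_complex (strictly_below A p)))
      (unit_sphere R (complex_dim (order_complex (below A p)))).

(** * Left regular bands *)

HB.mixin Record isLeftRegularBand B of Semigroup B := {
  lrb_idem : forall x : B, (x * x = x)%g;
  lrb_xyx : forall x y : B, (x * y * x = x * y)%g
}.

#[short(type="finLrbType")]
HB.structure Definition FinLrb :=
  {B of Finite B & Semigroup B & isLeftRegularBand B}.

(* The carrier of [B], as a poset for the order [a <= b] iff [b * a = a]. *)
Definition lrb_order (B : finLrbType) : Type := B.

HB.instance Definition _ (B : finLrbType) := Finite.on (lrb_order B).

Section LrbOrder.
Variable B : finLrbType.

Definition lrb_le : rel B := fun a b => (b * a == a)%g.

Lemma lrb_le_refl : reflexive lrb_le.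
Proof. by move=> a; apply/eqP/lrb_idem. Qed.

Lemma lrb_le_anti : antisymmetric lrb_le.
Proof.
by move=> a b /andP[/eqP ba /eqP ab]; rewrite -ab -{1}ba -lrb_xyx ba.
Qed.

Lemma lrb_le_trans : transitive lrb_le.
Proof.
move=> b a c /eqP ba /eqP cb; apply/eqP.
by rewrite -{1}ba mulgA cb.
Qed.

End LrbOrder.

Fact lrb_display : Order.disp_t. Proof. exact: Order.Disp tt tt. Qed.

HB.instance Definition _ (B : finLrbType) :=
  Order.Le_isPOrder.Build lrb_display (lrb_order B)
    (@lrb_le_refl B) (@lrb_le_anti B) (@lrb_le_trans B).

Section LrbPosets.
Variable B : finLrbType.

Definition left_ideal (b : B) : {set B} := [set (x * b)%g | x : B]%SET.

(* [{set B}] is ordered by inclusion, through [Order.DefaultSetSubsetOrder]. *)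
Definition Lambda : {set {set B}} := [set left_ideal b | b : B]%SET.

Definition lrb_ge (X : {set B}) : {set lrb_order B} :=
  [set b : B | (X <= left_ideal b)%O]%SET.

Definition connected_lrb (R : realType) : Prop :=
  forall X, X \in Lambda ->
    connected (realization R (order_complex (lrb_ge X))).

Definition CW_lrb (R : realType) : Prop :=
  forall X, X \in Lambda -> CW_poset R (lrb_ge X).

End LrbPosets.

(* The rank of an interval of a poset is its dimension. *)
Definition thin (d : Order.disp_t) (T : finPOrderType d) (A : {set T}) : Prop :=
  forall x y, x \in A -> y \in A -> (x <= y)%O ->
    complex_dim (order_complex (order_interval A x y)) = 2%N ->
    #|order_interval A x y| = 4%N.

(** * Semigroup algebras and incidence algebras *)

(* Elements are written in coordinates with respect to the defining basis. *)

Definition semigroup_algebra (K : fieldType) (B : finLrbType) : lmodType K :=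
  {ffun B -> K^o}.

Definition semigroup_algebra_mul (K : fieldType) (B : finLrbType)
    (f g : semigroup_algebra K B) : semigroup_algebra K B :=
  [ffun c => \sum_(a : B) \sum_(b : B | (a * b == c)%g) f a * g b].

Definition incidence_pair (d : Order.disp_t) (P : finPOrderType d) : finType :=
  {st : P * P | (st.1 <= st.2)%O}.

Definition incidence_algebra (K : fieldType) (d : Order.disp_t)
  (P : finPOrderType d) : lmodType K := {ffun incidence_pair P -> K^o}.

(* The bilinear extension of (s, t)(a, b) = (a, t) if b = s, and 0 otherwise. *)
Definition incidence_algebra_mul (K : fieldType) (d : Order.disp_t)
    (P : finPOrderType d) (f g : incidence_algebra K P) :
    incidence_algebra K P :=
  [ffun w => \sum_(u : incidence_pair P)
    \sum_(v : incidence_pair P |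
            ((val v).2 == (val u).1) && (val w == ((val v).1, (val u).2)))
      f u * g v].

(* Neither algebra carries a unit in its definition; a bijective multiplicative
   map preserves any identity element. *)
Definition iso_incidence_algebra (K : fieldType) (B : finLrbType)
    (d : Order.disp_t) (P : finPOrderType d) : Prop :=
  exists phi : {linear semigroup_algebra K B -> incidence_algebra K P},
    bijective phi /\
    {morph phi : f g /
       semigroup_algebra_mul f g >-> incidence_algebra_mul f g}.

(* Main.v *)
(* Write X = Bx and Y = By for the ends of an interval of rank 2 of Lambda(B),
   and let m >= 1 be the number of its middle elements.  By the CW hypothesis the
   faces below y in B_{>=X} form a circle, made of vertices (of support X) and edges
   (of support strictly between X and Y); every edge has two vertices and every
   vertex lies on two edges.  Each middle Z supports exactly two of these edges, as
   the faces below y in B_{>=Z} form a 0-sphere, so there are 2m edges and 2m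
   vertices.

   For X, Y and the middle Z, let E_X, E_Y, E_Z in kB correspond, under the
   isomorphism with I(P), to diagonal basis elements on which the characters of kB
   attached to X, Y, Z take the value 1.  Then E_Y kB E_X has dimension at most 1.
   The left module kB E_X has basis {v E_X | Bv = X}.  On a combination a of the 2m
   vertices below y which is killed by the augmentation and by the edges, i.e.,
   which satisfies m + 1 linear equations, y kB acts through the character of Y, so
   that y E_Y a = a; hence 2m - (m + 1) <= 1, i.e., m <= 2.  If m = 1, the two
   edges share their two vertices and the same analysis gives E_Y kB E_X = 0,
   whereas E_Z kB E_X and E_Y kB E_Z are nonzero; in an incidence algebra, the
   latter two imply that E_Y kB E_X is nonzero, by transitivity of the order of P. *)

Require Import Defs.
From HB Require Import structures.
From mathcomp Require Import all_boot all_order all_algebra.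
From mathcomp Require Import all_classical all_reals all_analysis.
From mathcomp Require Import ring lra.

Set Implicit Arguments.
Unset Strict Implicit.
Unset Printing Implicit Defensive.

Import Order.TTheory GRing.Theory Num.Theory.
Import numFieldNormedType.Exports.

Local Open Scope classical_set_scope.
Local Open Scope ring_scope.

(** * Circles *)

Section Continuity.

Lemma continuous_within_comp (S U V : topologicalType) (A : set U) (f : U -> V)
    (c : S -> U) :
  {within A, continuous f} -> continuous c -> (forall s, A (c s)) ->
  continuous (f \o c).
Proof.
move=> /subspace_continuousP fA cc Ac s.
apply: cvg_trans (fA _ (Ac s)) => P /=.
rewrite /within /= => /cc; rewrite /= !nbhs_simpl /=.
by apply: filterS => t; apply.
Qed.

Lemma continuous_ptws (S T : topologicalType) (I : Type) (c : S -> {ptws I -> T}) :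
  (forall i, continuous (fun s => c s i : T)) -> continuous c.
Proof.
move=> cc s; apply/cvg_sup => i; move: s.
apply/(@continuousP _ (initial_topology (@^~ i))) => A [B Bo <-].
exact: (proj1 (continuousP _) (cc i)).
Qed.

Lemma continuous_rV (R : numFieldType) (S : topologicalType) n (c : S -> 'rV[R]_n) :
  (forall i, continuous (fun s => c s ord0 i : R)) -> continuous c.
Proof.
move=> cc s P [Q Qn QP]; rewrite /= nbhs_simpl /=.
have : \forall t \near s, forall j : 'I_n, Q ord0 j (c t ord0 j).
  by apply: filter_forall => j; apply: cc (Qn ord0 j).
by apply: filterS => t Qt; apply: QP => i j; rewrite ord1.
Qed.

Variable R : realType.

Lemma positive_near0 (h : R -> R) :
  continuous h -> 0 < h 0 ->
  exists2 d, 0 < d & forall s, - d <= s <= d -> 0 < h s.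
Proof.
move=> hc h0.
have [e /= e0 he] := @cvgr_gt _ _ _ _ h (h 0) (hc 0) 0 h0.
exists (e / 2) => [|s sd]; first by rewrite divr_gt0.
by apply: he => /=; rewrite sub0r normrN ltr_norml; lra.
Qed.

End Continuity.

(** * Rotational coordinates on the unit circle *)

Section Circle.
Variable R : realType.
Implicit Types p w : 'rV[R]_2.

Let x0 w : R := w ord0 ord0.
Let x1 w : R := w ord0 ord_max.

(** With R^2 read as the complex plane, [circle_cos p w] and [circle_sin p w] are the real and
    imaginary parts of conj(p) w, and [circle_point p a b] is p (a + i b). *)
Definition circle_cos p w := x0 p * x0 w + x1 p * x1 w.
Definition circle_sin p w := x0 p * x1 w - x1 p * x0 w.

Definition circle_point p (a b : R) : 'rV[R]_2 :=
  \row_i (if i == ord0 then a * x0 p - b * x1 p else a * x1 p + b * x0 p).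

Let x0_point p a b : x0 (circle_point p a b) = a * x0 p - b * x1 p.
Proof. exact: mxE. Qed.

Let x1_point p a b : x1 (circle_point p a b) = a * x1 p + b * x0 p.
Proof. exact: mxE. Qed.

Lemma unit_sphere2E w : unit_sphere R 2 w <-> x0 w ^+ 2 + x1 w ^+ 2 = 1.
Proof.
rewrite /unit_sphere /= big_ord_recl big_ord1 /x0 /x1.
by rewrite (_ : lift _ _ = ord_max) //; apply: val_inj.
Qed.

Lemma rV2P w w' : x0 w = x0 w' -> x1 w = x1 w' -> w = w'.
Proof.
move=> e0 e1; apply/rowP => -[[|[|//]] lti].
  by move: e0; rewrite /x0; congr (w _ _ = w' _ _); apply: val_inj.
by move: e1; rewrite /x1; congr (w _ _ = w' _ _); apply: val_inj.
Qed.

Lemma circle_cos2Dsin2 p w : unit_sphere R 2 p -> unit_sphere R 2 w ->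
  circle_cos p w ^+ 2 + circle_sin p w ^+ 2 = 1.
Proof.
move=> /unit_sphere2E hp /unit_sphere2E hw.
rewrite -[RHS](mulr1 1) -{1}hp -hw /circle_cos /circle_sin; ring.
Qed.

Lemma circle_pointK p w : unit_sphere R 2 p ->
  circle_point p (circle_cos p w) (circle_sin p w) = w.
Proof.
move=> /unit_sphere2E hp.
by apply: rV2P; rewrite /circle_cos /circle_sin -[RHS]mul1r -hp
  ?x0_point ?x1_point; ring.
Qed.

Lemma circle_sin_point p a b : unit_sphere R 2 p ->
  circle_sin p (circle_point p a b) = b.
Proof.
move=> /unit_sphere2E hp; rewrite /circle_sin -[RHS]mulr1 -hp.
rewrite x0_point x1_point; ring.
Qed.

Lemma circle_cosxx p : unit_sphere R 2 p -> circle_cos p p = 1.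
Proof. by move=> /unit_sphere2E <-; rewrite /circle_cos; ring. Qed.

Lemma circle_sinxx p : circle_sin p p = 0.
Proof. by rewrite /circle_sin; ring. Qed.

Lemma circle_point_sphere p a b : unit_sphere R 2 p -> a ^+ 2 + b ^+ 2 = 1 ->
  unit_sphere R 2 (circle_point p a b).
Proof.
move=> /unit_sphere2E hp hab; apply/unit_sphere2E.
rewrite x0_point x1_point -[RHS]mulr1 -{1}hab -hp; ring.
Qed.

Lemma continuous_circle_cos_sin (S : topologicalType) p (c : S -> 'rV[R]_2) :
  continuous c ->
  continuous (fun s => circle_cos p (c s)) /\
  continuous (fun s => circle_sin p (c s)).
Proof.
move=> cc; have ci i : continuous (fun s => c s ord0 i).
  move=> s; exact: (@continuous_comp _ _ _ c (fun w => w ord0 i) s (cc s)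
    (@coord_continuous R 1 2 ord0 i (c s))).
have cM i (k : R) : continuous (fun s => k * c s ord0 i).
  by move=> s; apply: continuousM; [exact: cst_continuous | exact: ci].
split=> s.
  exact: (continuousD (cM _ _ s) (cM _ _ s)).
exact: (continuousB (cM _ _ s) (cM _ _ s)).
Qed.

End Circle.

(** * Segments in a geometric realization *)

Section Realization.
Variables (R : realType) (T : finType) (K : {set {set T}}).
Implicit Types (u v e : T).

Definition edge_point v e (l : R) : {ptws T -> R} :=
  fun u => (1 - l) * (u == v)%:R + l * (u == e)%:R.

Lemma sum_edge_point v e l : \sum_u edge_point v e l u = 1.
Proof.
rewrite big_split /= -!big_distrr /=.
have sum1 (a : T) : \sum_u (u == a)%:R = 1 :> R.
  by rewrite (bigD1 a) //= eqxx big1 ?addr0 // => u /negPf->.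
by rewrite !sum1; ring.
Qed.

(** The support is [{v}] at [l = 0] and [{v, e}] for [0 < l < 1]. The end [l = 1] is left out
    because the vertex [e] alone is not assumed to be a face. *)
Lemma edge_point_realization v e l : [set v]%SET \in K ->
  [set v; e]%SET \in K -> 0 <= l < 1 -> realization R K (edge_point v e l).
Proof.
move=> Kv Kve /andP[l0 l1]; split=> [u||]; last 2 first.
- exact: sum_edge_point.
- rewrite /edge_point; have [->|l_neq0] := eqVneq l 0.
    rewrite (_ : [set u | _]%SET = [set v]%SET) //.
    apply/setP=> u; rewrite !inE mul0r addr0 subr0 mul1r.
    by case: (u == v); rewrite ?oner_eq0 ?eqxx.
  rewrite (_ : [set u | _]%SET = [set v; e]%SET) //.
  apply/setP=> u; rewrite !inE; case: (u == v); case: (u == e) => /=;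
    rewrite ?mulr1 ?mulr0 ?addr0 ?add0r ?subrK ?oner_eq0 ?eqxx ?l_neq0 //.
  by rewrite subr_eq0 eq_sym lt_eqF.
by rewrite /edge_point addr_ge0 // mulr_ge0 // subr_ge0 ltW.
Qed.

Lemma edge_point0 v e e' : edge_point v e 0 = edge_point v e' 0.
Proof. by apply/funext=> u; rewrite /edge_point !mul0r. Qed.

(** A map from the whole line to [0, 1) that vanishes only at 0, so that an edge leaving [v] is
    followed by a path defined on all of [R]. *)
Definition arc_param (s : R) : R := s ^+ 2 / (1 + s ^+ 2).

Lemma arc_param_ge0_lt1 s : 0 <= arc_param s < 1.
Proof.
have s2 := sqr_ge0 s; rewrite /arc_param.
by rewrite divr_ge0 ?ltr_pdivrMr /= ?mul1r; lra.
Qed.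

Lemma arc_param_eq0 s : arc_param s = 0 -> s = 0.
Proof.
move/eqP; rewrite /arc_param mulf_eq0 invr_eq0 sqrf_eq0.
have s2 := sqr_ge0 s; case/orP=> /eqP //; lra.
Qed.

Lemma arc_param0 : arc_param 0 = 0.
Proof. by rewrite /arc_param expr0n mul0r. Qed.

Lemma continuous_inv1Dsqr : continuous (fun s : R => (1 + s ^+ 2)^-1).
Proof.
move=> s; apply: cvgV; first by apply: lt0r_neq0; have := sqr_ge0 s; lra.
by apply: cvgD; [exact: cvg_cst | exact: exprn_continuous].
Qed.

Lemma continuous_arc_param : continuous arc_param.
Proof.
by move=> s; apply: cvgM; [exact: exprn_continuous | exact: continuous_inv1Dsqr].
Qed.

Lemma continuous_edge_point v e : continuous (fun s => edge_point v e (arc_param s)).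
Proof.
apply: continuous_ptws => u s; apply: cvgD; apply: cvgM; try exact: cvg_cst.
  by apply: cvgB; [exact: cvg_cst | exact: continuous_arc_param].
exact: continuous_arc_param.
Qed.

End Realization.

(** * Complexes homeomorphic to a circle *)

Section CircleRealization.
Variables (R : realType) (T : finType) (K : {set {set T}}).
Implicit Types (u v e : T).
Hypothesis circleK : homeomorphic (realization R K) (unit_sphere R 2).

Lemma intermediate_value (h : R -> R) (a b c : R) :
  continuous h -> a <= b -> Num.min (h a) (h b) <= c <= Num.max (h a) (h b) ->
  exists2 s, a <= s <= b & h s = c.
Proof.
move=> hc ab cab.
by have [s sab <-] := IVT ab (continuous_subspaceT hc) cab; exists s.
Qed.

(* Near [f v] the circle is a graph over the tangent line, whose coordinate is
   [circle_sin]; two arcs leaving [f v] on the same side of it must meet again,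
   and there are only two sides. *)
Lemma circle_card_link v (N : {set T}) : [set v]%SET \in K ->
  (forall e, e \in N -> [set v; e]%SET \in K) -> v \notin N -> (#|N| <= 2)%N.
Proof.
have [f [g [[fc fS] _ fK _]]] := circleK.
move=> Kv KN vN; pose arc e (s : R) := edge_point v e (arc_param s).
have arcK e s : e \in N -> realization R K (arc e s).
  by move=> eN; apply: edge_point_realization => //;
    [exact: KN | exact: arc_param_ge0_lt1].
pose p := f (edge_point v v (0 : R)).
have arc0 e : arc e 0 = edge_point v v (0 : R).
  by rewrite /arc arc_param0; exact: edge_point0.
have [->|[e0 e0N]] := finset.set_0Vmem N; first by rewrite cards0.
have Sp : unit_sphere R 2 p by rewrite /p -(arc0 e0); exact/fS/arcK.
pose C e s := circle_cos p (f (arc e s)).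
pose S e s := circle_sin p (f (arc e s)).
have CS1 e s : e \in N -> C e s ^+ 2 + S e s ^+ 2 = 1.
  by move=> eN; apply: circle_cos2Dsin2 => //; exact/fS/arcK.
have CSc e : e \in N -> continuous (C e) /\ continuous (S e).
  move=> eN; apply: continuous_circle_cos_sin.
  apply: (continuous_within_comp fc) => [|s]; last exact: arcK.
  exact: continuous_edge_point.
(* [side e b]: on the half circle around [p], the arc along [e] reaches every small enough
   tangential coordinate of sign [(-1) ^+ b]. *)
pose side e (b : bool) := exists2 m, 0 < m & forall c, 0 < c <= m ->
  exists2 s, S e s = (-1) ^+ b * c & 0 < C e s.
have sideP e : e \in N -> exists b, side e b.
  move=> eN; have [Cc Sc] := CSc e eN.
  have [|d d0 Cd] := positive_near0 Cc.
    by rewrite /C arc0 circle_cosxx // ltr01.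
  have S0 : S e 0 = 0 by rewrite /S arc0 circle_sinxx.
  (* A zero sine with a positive cosine puts the arc back at [p]; injectivity of [f] then forces
     [d = 0]. *)
  have Sd : S e d != 0.
    apply/eqP=> Sd; have := CS1 e d eN; rewrite Sd expr0n addr0 => /eqP.
    rewrite sqrf_eq1 => /orP[] /eqP Cd1; last first.
      by have := Cd d; rewrite Cd1 lexx; lra.
    have : f (arc e d) = p.
      by rewrite -(circle_pointK (f (arc e d)) Sp) -/(C e d) -/(S e d) Cd1 Sd
        -(circle_cosxx Sp) -(circle_sinxx p) circle_pointK.
    rewrite /p -(arc0 e) => /(congr1 g); rewrite !fK; [|exact: arcK..].
    move/(congr1 (@^~ e)); rewrite /arc arc_param0 /edge_point eqxx.
    have /negPf-> : e != v by apply: contraNneq vN => <-.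
    rewrite !mulr0 mulr1 !add0r mul0r => /arc_param_eq0; lra.
  pose b := S e d < 0; exists b.
  have bS : (-1) ^+ b * S e d = `|S e d|.
    by rewrite /b; case: ltrP => h; rewrite ?expr1 ?expr0;
      [rewrite ltr0_norm | rewrite ger0_norm]; rewrite // ?mulN1r ?mul1r.
  exists `|S e d|; first by rewrite normr_gt0.
  move=> c c_m.
  have [||s /andP[s0 sd] Ss] := @intermediate_value (S e) 0 d ((-1) ^+ b * c) Sc.
  - exact: ltW.
  - rewrite S0; move: c_m; rewrite -bS ge_min le_max.
    by case: (b); rewrite ?expr1 ?expr0; lra.
  - by exists s => //; apply: Cd; lra.
have side_inj e e' b : e \in N -> e' \in N -> side e b -> side e' b -> e = e'.
  move=> eN e'N [m m0 mP] [m' m'0 m'P]; apply/eqP/negPn/negP => ee'.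
  pose c := Num.min m m'.
  have c0 : 0 < c by rewrite lt_min m0.
  have [|s Ss Cs] := mP c; first by rewrite c0 ge_min lexx.
  have [|s' Ss' Cs'] := m'P c; first by rewrite c0 ge_min lexx orbT.
  (* Equal sines and positive cosines give the same point of the circle, hence of the realization.
     Lying on the other edge too, it has coordinate 0 at [e], so [s = 0], against [0 < c]. *)
  have eqC : C e s = C e' s'.
    apply/eqP; rewrite -(eqrXn2 (n := 2)) ?ltW //; apply/eqP.
    apply: (addIr (S e s ^+ 2)); rewrite CS1 //.
    by rewrite Ss -Ss' CS1.
  have : f (arc e s) = f (arc e' s').
    rewrite -(circle_pointK (f (arc e s)) Sp) -(circle_pointK (f (arc e' s')) Sp).
    by rewrite -/(C e s) -/(S e s) -/(C e' s') -/(S e' s') eqC Ss Ss'.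
  move/(congr1 g); rewrite !fK; [|exact: arcK..].
  move/(congr1 (@^~ e)); rewrite /arc /edge_point eqxx (negPf ee').
  have /negPf-> : e != v by apply: contraNneq vN => <-.
  rewrite !mulr0 mulr1 !add0r => /arc_param_eq0 s0.
  move: Ss; rewrite /S s0 arc0 circle_sinxx => /esym/eqP.
  by rewrite mulf_eq0 signr_eq0 /= => /eqP; lra.
rewrite -card_bool; apply: (@leq_card_in _ _ (fun e => `[< side e true >]) N).
move=> e e' eN e'N; have [b eb] := sideP e eN; have [b' eb'] := sideP e' e'N.
case: asboolP => [he|he]; case: asboolP => [he'|he'] //= _.
  exact: side_inj he he'.
case: b eb => [/he//|eb]; case: b' eb' => [/he'//|eb'].
exact: side_inj eb eb'.
Qed.

(* The coordinate at [v] is maximal exactly at [f v], so along the circle it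
   takes every value slightly below 1 on both sides of [f v]. *)
Lemma circle_no_end v e : [set v]%SET \in K ->
  (forall s : {set T}, s \in K -> v \in s -> s \subset [set v; e]%SET) -> False.
Proof.
have [f [g [[fc fS] [gc gS] fK gK]]] := circleK.
move=> Kv Ke; pose p := f (edge_point v v (0 : R)).
have Kpt : realization R K (edge_point v v (0 : R)).
  by apply: edge_point_realization; rewrite ?finset.setUid ?lexx ?ltr01.
have Sp : unit_sphere R 2 p by exact: fS.
(* The rational parametrization of the circle minus the antipode of [p]; it sends 0 to [p], and the
   sine at [q t] has the sign of [t]. *)
pose q (t : R) := circle_point p ((1 - t ^+ 2) / (1 + t ^+ 2)) (2 * t / (1 + t ^+ 2)).
have D0 (t : R) : 1 + t ^+ 2 != 0 by apply: lt0r_neq0; have := sqr_ge0 t; lra.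
have Sq t : unit_sphere R 2 (q t).
  apply: circle_point_sphere => //; have := D0 t.
  by move=> Dt; field.
have sinq t : circle_sin p (q t) = 2 * t / (1 + t ^+ 2) by exact: circle_sin_point.
have q0 : q 0 = p.
  rewrite -(circle_pointK p Sp) circle_cosxx // circle_sinxx /q.
  by congr circle_point; field.
pose h (t : R) : R := g (q t) v.
have gqK t : realization R K (g (q t)) by exact: gS.
have qc : continuous q.
  have ac : continuous (fun t : R => (1 - t ^+ 2) / (1 + t ^+ 2)).
    move=> t; apply: cvgM; last exact: continuous_inv1Dsqr.
    by apply: cvgB; [exact: cvg_cst | exact: exprn_continuous].
  have bc : continuous (fun t : R => 2 * t / (1 + t ^+ 2)).
    move=> t; apply: cvgM; last exact: continuous_inv1Dsqr.
    by apply: cvgM; [exact: cvg_cst | exact: cvg_id].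
  apply: continuous_rV => i; rewrite /q /circle_point.
  under eq_fun do rewrite mxE.
  by case: (i == _) => t; [apply: cvgB | apply: cvgD]; apply: cvgM;
    (exact: cvg_cst || exact: ac || exact: bc).
have hc : continuous h.
  move=> t; apply: (@continuous_comp _ _ _ (g \o q) (fun x => x v)).
    exact: continuous_within_comp.
  exact: (@proj_continuous T (fun=> R) v).
(* A point with positive coordinate at [v] lies on the segment from [v] to [e], so this coordinate
   determines it. *)
have support_v (x : {ptws T -> R}) : realization R K x -> 0 < x v ->
    forall u, x u = edge_point v e (1 - x v) u.
  move=> [x0 sumx Kx] xv.
  have xN0 u : x u != 0 -> u \in [set v; e]%SET.
    move=> xu; apply: (fintype.subsetP (Ke _ Kx _)); rewrite inE //.
    exact: lt0r_neq0.
  have xe0 u : u != v -> u != e -> x u = 0.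
    move=> uv ue; apply/eqP/negPn/negP => /xN0.
    by rewrite !inE (negPf uv) (negPf ue).
  move: sumx; rewrite (bigD1 v) //=; have [ev|ev] := eqVneq e v.
    rewrite big1 ?addr0 => [xv1 u|u uv]; last by rewrite xe0 // ev.
    rewrite /edge_point ev xv1; have [->|uv] := eqVneq u v.
      by rewrite xv1 /=; ring.
    by rewrite xe0 ?ev //=; ring.
  rewrite (bigD1 e) //= big1 => [xv1 u|u /andP[]]; last exact: xe0.
  rewrite /edge_point; have [->|uv] := eqVneq u v.
    by rewrite eq_sym (negPf ev) /=; ring.
  have [->|ue] := eqVneq u e; last by rewrite xe0 //=; ring.
  by rewrite mulr0 add0r mulr1 -xv1; ring.
have h1 t : h t = 1 -> t = 0.
  move=> ht; have : g (q t) = edge_point v v 0.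
    apply/funext=> u; rewrite support_v // -/(h t) ht ?ltr01 // subrr.
    by rewrite (edge_point0 R v e v).
  move/(congr1 f); rewrite gK // -/p => qp.
  have := sinq t; rewrite qp circle_sinxx => /esym/eqP.
  by rewrite mulf_eq0 invr_eq0 (negPf (D0 t)) orbF mulf_eq0 pnatr_eq0 => /eqP.
have h0 : h 0 = 1.
  by rewrite /h q0 /p fK // /edge_point eqxx mul0r addr0 subr0 mulr1.
have hle1 t : h t <= 1.
  have [x0 <- _] := gqK t; rewrite (bigD1 v) //= lerDl.
  by apply: sumr_ge0 => u _; exact: x0.
have [|d d0 hd] := positive_near0 hc; first by rewrite h0.
(* The larger end value is less than the maximum 1, attained only at 0, so [h] takes it on each side
   of 0. *)
pose c := Num.max (h (- d)) (h d).
have c0 : 0 < c by rewrite lt_max !hd ?orbT //; lra.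
have cle1 : c <= 1 by rewrite ge_max !hle1.
have cl : h (- d) <= c by rewrite le_max lexx.
have cr : h d <= c by rewrite le_max lexx orbT.
have c1 : c != 1.
  apply/eqP; rewrite /c; case: (lerP (h (- d)) (h d)) => _ /h1; lra.
clearbody c.
have [||t /andP[t0 td] ht] := @intermediate_value h (- d) 0 c hc; first lra.
  by rewrite h0 ge_min le_max cle1 cl orbT.
have [||t' /andP[t'0 t'd] ht'] := @intermediate_value h 0 d c hc; first lra.
  by rewrite h0 ge_min le_max cle1 cr orbT.
have t_lt0 : t < 0.
  by rewrite lt_neqAle td andbT; apply: contra_neq c1 => t_0; rewrite -ht t_0.
have t'_gt0 : 0 < t'.
  by rewrite lt_neqAle t'0 andbT; apply: contra_neq c1 => t_0; rewrite -ht' -t_0.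
(* Equal coordinates at [v] make the two points equal, while their sines have opposite signs. *)
have : q t = q t'.
  rewrite -(gK (q t)) // -(gK (q t')) //; congr f; apply/funext => u.
  by rewrite [LHS]support_v 1?[RHS]support_v // -/(h t) -/(h t') ?ht ?ht'.
move/(congr1 (circle_sin p)); rewrite !sinq => st.
have : 2 * t / (1 + t ^+ 2) < 0.
  by rewrite pmulr_llt0 ?invr_gt0; [lra | have := sqr_ge0 t; lra].
rewrite st ltNge => /negP; apply; apply: divr_ge0; first lra.
by have := sqr_ge0 t'; lra.
Qed.

End CircleRealization.

(** The vertices inject into the two points of the 0-sphere; conversely a complex with at most one
    vertex has at most one point. *)
Lemma card_sphere0 (R : realType) (d : Order.disp_t) (T : finPOrderType d)
    (A : {set T}) :
  homeomorphic (realization R (order_complex A)) (unit_sphere R 1) ->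
  #|A| = 2%N.
Proof.
move=> [f [g [[_ fS] [_ gS] fK gK]]].
have S0E (w : 'rV[R]_1) : unit_sphere R 1 w <-> w ord0 ord0 ^+ 2 = 1.
  by rewrite /unit_sphere /= big_ord1.
have Kv v : v \in A -> [set v]%SET \in order_complex A.
  move=> vA; rewrite inE finset.sub1set vA /=; apply/andP; split.
    by apply/finset.set0Pn; exists v; rewrite inE.
  apply/'forall_implyP => x; rewrite inE => /eqP->.
  by apply/'forall_implyP => y; rewrite inE => /eqP->; exact: comparablexx.
have Kpt v : v \in A -> realization R (order_complex A) (edge_point v v 0).
  move=> vA; apply: edge_point_realization; rewrite ?finset.setUid ?Kv //.
  by rewrite lexx ltr01.
apply/eqP; rewrite eqn_leq; apply/andP; split.
  rewrite -card_bool.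
  apply: (@leq_card_in _ _ (fun v => f (edge_point v v 0) ord0 ord0 == 1) A).
  move=> v u vA uA; have /S0E/eqP := fS _ (Kpt v vA).
  have /S0E/eqP := fS _ (Kpt u uA); rewrite !sqrf_eq1.
  move=> hu hv huv; have : f (edge_point v v 0) = f (edge_point u u 0).
    apply/rowP => i; rewrite ord1; move: hu hv huv.
    by case: eqP => [-> _|_ /= /eqP->]; case: eqP => [-> _|_ /= /eqP->].
  move/(congr1 g); rewrite !fK; [|exact: Kpt..] => /(congr1 (@^~ v)).
  rewrite /edge_point eqxx; case: eqP => // _ /eqP.
  by rewrite !mul0r !mulr0 !addr0 subr0 mulr1 oner_eq0.
pose w b : 'rV[R]_1 := const_mx ((-1) ^+ (b : bool)).
have Sw b : unit_sphere R 1 (w b) by apply/S0E; rewrite mxE sqrr_sign.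
rewrite ltnNge; apply/negP => /card_le1_eqP A1'.
have A1 v u : v \in A -> u \in A -> v = u by move=> vA uA; exact: A1'.
have : g (w true) = g (w false).
  have := gS _ (Sw true); have := gS _ (Sw false).
  move: (g (w true)) (g (w false)) => x y [_ y1 yK] [_ x1 xK].
  have supp1 (z : {ptws T -> R}) : \sum_v z v = 1 ->
     [set v | z v != 0]%SET \in order_complex A ->
     exists2 v, v \in A & forall u, z u = (u == v)%:R.
    move=> z1; rewrite inE => /and3P[/fintype.subsetP zA /finset.set0Pn[v vz] _].
    exists v; first exact: zA.
    have z0 u : u != v -> z u = 0.
      move=> uv; apply/eqP/negPn/negP => zu; case/eqP: uv.
      by apply: A1; apply: zA; rewrite // inE.
    move=> u; have [->|/z0//] := eqVneq u v.
    by move: z1; rewrite (bigD1 v) //= big1 ?addr0.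
  have [v vA xv] := supp1 x x1 xK; have [v' v'A yv] := supp1 y y1 yK.
  by apply/funext=> u; rewrite xv yv (A1 v v').
move/(congr1 f); rewrite !gK // => /(congr1 (fun m : 'rV_1 => m ord0 ord0)).
by rewrite !mxE expr0 expr1; lra.
Qed.

(** * The semigroup algebra of a left regular band *)

Section SupportPreorder.
Variable B : finLrbType.
Implicit Types a b c x y : B.
Local Open Scope group_scope.

(** Inclusion of the left ideals [Ba] and [Bb], by [left_ideal_le]; the quotient of this preorder is
    [Lambda B]. *)
Definition supp_le a b : bool := a * b == a.
Definition supp_eq a b : bool := supp_le a b && supp_le b a.

Lemma supp_le_refl : reflexive supp_le.
Proof. by move=> a; rewrite /supp_le lrb_idem. Qed.

Lemma supp_le_trans : transitive supp_le.
Proof.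
move=> b a c /eqP ab /eqP bc; apply/eqP.
by rewrite -[in LHS]ab -mulgA bc.
Qed.

(** The support of a product is the meet of the supports; this makes [supp_char] multiplicative. *)
Lemma supp_le_mul a b c : supp_le a (b * c) = supp_le a b && supp_le a c.
Proof.
apply/eqP/andP => [abc | [/eqP ab /eqP ac]]; last by rewrite mulgA ab ac.
split; apply/eqP; rewrite -[in LHS]abc; first by rewrite -mulgA lrb_xyx.
by rewrite -!mulgA lrb_idem.
Qed.

Lemma supp_mull a b : supp_le (a * b) a.
Proof. by rewrite /supp_le lrb_xyx. Qed.

Lemma supp_mulr a b : supp_le (a * b) b.
Proof. by rewrite /supp_le -mulgA lrb_idem. Qed.

(** Right multiplication fixes an element unless it lowers its support; the triangularity arguments
    below rest on this. *)
Lemma supp_le_absorb c d : supp_le c (c * d) -> c * d = c.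
Proof. by move/eqP; rewrite mulgA lrb_idem. Qed.

Lemma left_idealP a b : reflect (exists c, a = c * b) (a \in left_ideal b).
Proof.
by apply: (iffP imsetP) => [[c _ ->] | [c ->]]; exists c.
Qed.

Lemma left_ideal_le a b : (left_ideal a <= left_ideal b)%O = supp_le a b.
Proof.
rewrite -[(_ <= _)%O]/(left_ideal a \subset left_ideal b).
apply/idP/eqP => [/fintype.subsetP sab | ab].
  have /sab /left_idealP[c ->] : a \in left_ideal a.
    by apply/left_idealP; exists a; rewrite lrb_idem.
  by rewrite -mulgA lrb_idem.
apply/fintype.subsetP => _ /left_idealP[c ->]; apply/left_idealP.
by exists (c * a); rewrite -mulgA ab.
Qed.

Lemma left_ideal_eq a b : (left_ideal a == left_ideal b) = supp_eq a b.
Proof. by rewrite eq_le !left_ideal_le. Qed.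

End SupportPreorder.

(** * Product and characters of the semigroup algebra *)

Section SemigroupAlgebra.
Variables (K : fieldType) (B : finLrbType).
Implicit Types (b c d x y w : B) (f g h : semigroup_algebra K B).

Local Notation "f ** g" := (semigroup_algebra_mul f g)
  (at level 40, left associativity).

Definition basis_elt b : semigroup_algebra K B := [ffun c => (c == b)%:R].

Lemma semigroup_algebra_expand f : f = \sum_b f b *: basis_elt b.
Proof.
apply/ffunP => c; rewrite sum_ffunE (bigD1 c) //= big1 ?addr0 => [|b bc].
  by rewrite !ffunE eqxx /GRing.scale /= mulr1.
by rewrite !ffunE eq_sym (negPf bc) /GRing.scale /= mulr0.
Qed.

Lemma semigroup_mul_linearl g : linear (fun f => f ** g).
Proof.
move=> k f f'; apply/ffunP => c; rewrite !ffunE /GRing.scale /= big_distrr /=.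
rewrite -big_split; apply: eq_bigr => a _ /=; rewrite big_distrr /= -big_split.
by apply: eq_bigr => b _ /=; rewrite !ffunE /GRing.scale /=; ring.
Qed.

Lemma semigroup_mul_linearr f : linear (semigroup_algebra_mul f).
Proof.
move=> k g g'; apply/ffunP => c; rewrite !ffunE /GRing.scale /= big_distrr /=.
rewrite -big_split; apply: eq_bigr => a _ /=; rewrite big_distrr /= -big_split.
by apply: eq_bigr => b _ /=; rewrite !ffunE /GRing.scale /=; ring.
Qed.

HB.instance Definition _ f := GRing.isLinear.Build K (semigroup_algebra K B)
  (semigroup_algebra K B) *:%R (semigroup_algebra_mul f)
  (semigroup_mul_linearr f).

Definition semigroup_mulr g f := f ** g.

HB.instance Definition _ g := GRing.isLinear.Build K (semigroup_algebra K B)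
  (semigroup_algebra K B) *:%R (semigroup_mulr g) (semigroup_mul_linearl g).

Lemma semigroup_mul_suml (I : finType) (F : I -> semigroup_algebra K B) g :
  (\sum_i F i) ** g = \sum_i F i ** g.
Proof. exact: (linear_sum (semigroup_mulr g)). Qed.

Lemma semigroup_mul_scalel k f g : (k *: f) ** g = k *: (f ** g).
Proof. exact: (linearZZ (semigroup_mulr g)). Qed.

Lemma semigroup_mulBl f f' g : (f - f') ** g = f ** g - f' ** g.
Proof. exact: (linearB (semigroup_mulr g)). Qed.

Lemma semigroup_mul0l g : 0 ** g = 0.
Proof. exact: (linear0 (semigroup_mulr g)). Qed.

Lemma basis_mulE b f c : (basis_elt b ** f) c = \sum_(d | (b * d == c)%g) f d.
Proof.
rewrite ffunE (bigD1 b) //= [X in _ + X]big1 ?addr0 => [|a ab].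
  by apply: eq_bigr => d _; rewrite ffunE eqxx mul1r.
by apply: big1 => d _; rewrite ffunE (negPf ab) mul0r.
Qed.

Lemma basis_mul b c : basis_elt b ** basis_elt c = basis_elt (b * c)%g.
Proof.
apply/ffunP => d; rewrite basis_mulE ffunE.
have [<-|dbc] := eqVneq (b * c)%g d.
  rewrite (bigD1 c) //= ffunE eqxx big1 ?addr0 // => a /andP[_ ac].
  by rewrite ffunE (negPf ac).
apply: big1 => a /eqP bad; rewrite ffunE; case: eqP => // ac.
by case/eqP: dbc; rewrite -ac.
Qed.

Lemma semigroup_mulA f g h : f ** (g ** h) = f ** g ** h.
Proof.
rewrite (semigroup_algebra_expand f) !semigroup_mul_suml.
apply: eq_bigr => a _; rewrite !semigroup_mul_scalel; congr (_ *: _).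
rewrite (semigroup_algebra_expand g) semigroup_mul_suml !linear_sum.
rewrite semigroup_mul_suml; apply: eq_bigr => b _.
rewrite !semigroup_mul_scalel !linearZ /= semigroup_mul_scalel; congr (_ *: _).
rewrite (semigroup_algebra_expand h) !linear_sum; apply: eq_bigr => c _.
by rewrite !linearZ /= !basis_mul mulgA.
Qed.

(** The character of kB attached to the left ideal [Bx]. *)
Definition supp_char x f : K := \sum_(b | supp_le x b) f b.

Lemma supp_char_linear x : linear (supp_char x : _ -> K^o).
Proof.
move=> k f g; rewrite /supp_char /GRing.scale /= big_distrr -big_split.
by apply: eq_bigr => b _ /=; rewrite !ffunE.
Qed.

HB.instance Definition _ x := GRing.isLinear.Build K (semigroup_algebra K B)
  K^o *:%R (supp_char x) (supp_char_linear x).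

Lemma supp_charZ x k f : supp_char x (k *: f) = k * supp_char x f.
Proof. exact: (linearZZ (supp_char x : {linear _ -> K^o})). Qed.

Lemma supp_char_sum x (I : finType) (F : I -> semigroup_algebra K B) :
  supp_char x (\sum_i F i) = \sum_i supp_char x (F i).
Proof. exact: (linear_sum (supp_char x : {linear _ -> K^o})). Qed.

Lemma supp_charB x f g : supp_char x (f - g) = supp_char x f - supp_char x g.
Proof. exact: (linearB (supp_char x : {linear _ -> K^o})). Qed.

Lemma supp_char_basis x b : supp_char x (basis_elt b) = (supp_le x b)%:R.
Proof.
rewrite /supp_char; have [xb|xb] := boolP (supp_le x b).
  rewrite (bigD1 b) //= ffunE eqxx big1 ?addr0 // => c /andP[_ cb].
  by rewrite ffunE (negPf cb).
apply: big1 => c xc; rewrite ffunE; case: eqP => // cb.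
by case/negP: xb; rewrite -cb.
Qed.

Lemma supp_charM x f g : supp_char x (f ** g) = supp_char x f * supp_char x g.
Proof.
rewrite (semigroup_algebra_expand f) semigroup_mul_suml !supp_char_sum big_distrl /=.
apply: eq_bigr => a _; rewrite semigroup_mul_scalel !supp_charZ -mulrA; congr (_ * _).
rewrite (semigroup_algebra_expand g) linear_sum !supp_char_sum big_distrr /=.
apply: eq_bigr => b _; rewrite linearZ /= !supp_charZ basis_mul !supp_char_basis.
by rewrite supp_le_mul mulrCA -natrM mulnb.
Qed.

Lemma supp_char_eq x y f : supp_eq x y -> supp_char x f = supp_char y f.
Proof.
move=> /andP[xy yx]; apply: eq_bigl => b.
by apply/idP/idP; apply: supp_le_trans.
Qed.

End SemigroupAlgebra.

(** * Incidence algebras *)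

Section IncidenceAlgebra.
Variables (K : fieldType) (d : Order.disp_t) (P : finPOrderType d).
Implicit Types (f g : incidence_algebra K P) (u w : incidence_pair P) (p q : P).

Definition incidence_basis u : incidence_algebra K P := [ffun w => (w == u)%:R].

Definition incidence_diag p : incidence_pair P := Sub (p, p) (lexx p).

Lemma incidence_diagE p : val (incidence_diag p) = (p, p).
Proof. exact: SubK. Qed.

(** Pairs compose like arrows, right factor first, so a diagonal element on the left selects the
    upper end of a pair. *)
Lemma incidence_mul_diagl q f w :
  incidence_algebra_mul (incidence_basis (incidence_diag q)) f w =
  if (val w).2 == q then f w else 0.
Proof.
rewrite ffunE (bigD1 (incidence_diag q)) //= [X in _ + X]big1 ?addr0; last first.
  by move=> u uq; apply: big1 => v _; rewrite ffunE (negPf uq) mul0r.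
have [w2|w2] := eqVneq; last first.
  apply: big1 => v /andP[_ /eqP wv]; case/eqP: w2.
  by rewrite wv.
rewrite (bigD1 w) /=; last by rewrite /= w2 eqxx -w2 -surjective_pairing eqxx.
rewrite ffunE eqxx mul1r big1 ?addr0 // => v /andP[/andP[/eqP v2 /eqP wv] vw].
case/eqP: vw; apply: val_inj => /=; rewrite wv [LHS]surjective_pairing.
by rewrite v2.
Qed.

Lemma incidence_mul_diagr p f w :
  incidence_algebra_mul f (incidence_basis (incidence_diag p)) w =
  if (val w).1 == p then f w else 0.
Proof.
rewrite ffunE (exchange_big_dep predT) //= (bigD1 (incidence_diag p)) //=.
rewrite [X in _ + X]big1 ?addr0; last first.
  by move=> u uq; apply: big1 => v _; rewrite [X in _ * X]ffunE (negPf uq) mulr0.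
have [w1|w1] := eqVneq; last first.
  apply: big1 => v /andP[_ /eqP wv]; case/eqP: w1.
  by rewrite wv.
rewrite (bigD1 w) /=; last by rewrite /= w1 eqxx -w1 -surjective_pairing eqxx.
rewrite ffunE eqxx mulr1 big1 ?addr0 // => v /andP[/andP[/eqP v2 /eqP wv] vw].
case/eqP: vw; apply: val_inj => /=; rewrite wv [LHS]surjective_pairing.
by rewrite -v2.
Qed.

Lemma incidence_sum_diag f :
  incidence_algebra_mul (\sum_p incidence_basis (incidence_diag p)) f = f.
Proof.
apply/ffunP => w; rewrite ffunE.
transitivity (\sum_p incidence_algebra_mul (incidence_basis (incidence_diag p)) f w).
  under [RHS]eq_bigr do rewrite ffunE.
  rewrite exchange_big; apply: eq_bigr => u _ /=; rewrite exchange_big.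
  by apply: eq_bigr => v _; rewrite sum_ffunE big_distrl.
under eq_bigr do rewrite incidence_mul_diagl.
by rewrite -big_mkcond (big_pred1 (val w).2) // => p; rewrite /= eq_sym.
Qed.

End IncidenceAlgebra.

(** * Idempotents transported from the incidence algebra *)

Section IncidenceIsomorphism.
Variables (K : fieldType) (B : finLrbType) (d : Order.disp_t) (P : finPOrderType d).
Local Notation kB := (semigroup_algebra K B).
Variable phi : {linear kB -> incidence_algebra K P}.
Hypothesis phiM : {morph phi : f g /
  semigroup_algebra_mul f g >-> incidence_algebra_mul f g}.
Variable psi : incidence_algebra K P -> kB.
Hypothesis phiK : cancel phi psi.
Hypothesis psiK : cancel psi phi.
Implicit Types (f g a : kB) (p q : P) (x y : B).

Local Notation "f ** g" := (semigroup_algebra_mul f g)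
  (at level 40, left associativity).

Definition idem p : kB := psi (incidence_basis K (incidence_diag p)).

Lemma phi_inj : injective phi. Proof. exact: can_inj phiK. Qed.

(** The corner from [idem p] to [idem q] is thus at most a line, and it is zero unless [p <= q]. *)
Lemma phi_idem_mul q p a (w : incidence_pair P) :
  phi (idem q ** (a ** idem p)) w = if val w == (p, q) then phi a w else 0.
Proof.
rewrite !phiM /idem !psiK incidence_mul_diagl incidence_mul_diagr.
by rewrite [val w]surjective_pairing xpair_eqE andbC; case: eqP; case: eqP.
Qed.

Lemma idem_mul_eq0 q p a : ~~ (p <= q)%O -> idem q ** (a ** idem p) = 0.
Proof.
move=> pq; apply: phi_inj; rewrite linear0; apply/ffunP => w.
rewrite phi_idem_mul ffunE; case: eqP => // wpq.
by case/negP: pq; have := valP w; rewrite wpq.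
Qed.

Lemma idem_mul_coef_eq0 q p a :
  (forall w : incidence_pair P, val w = (p, q) -> phi a w = 0) ->
  idem q ** (a ** idem p) = 0.
Proof.
move=> apq; apply: phi_inj; rewrite linear0; apply/ffunP => w.
by rewrite phi_idem_mul ffunE; case: eqP => // /apq.
Qed.

Lemma idem_mul_line p q : (p <= q)%O ->
  exists a, [/\ a != 0, idem q ** a = a & a ** idem p = a].
Proof.
move=> pq; pose w0 : incidence_pair P := Sub (p, q) pq.
pose a := psi (incidence_basis K w0).
have aw w : phi a w = (w == w0)%:R by rewrite /a psiK ffunE.
clearbody a; exists a; split.
- apply/eqP => a0; have := aw w0; rewrite a0 linear0 ffunE eqxx => /eqP.
  by rewrite eq_sym oner_eq0.
- apply: phi_inj; apply/ffunP => w; rewrite phiM psiK incidence_mul_diagl aw.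
  by case: eqP => //; case: eqP => // -> /= /(_ erefl).
apply: phi_inj; apply/ffunP => w; rewrite phiM psiK incidence_mul_diagr aw.
by case: eqP => //; case: eqP => // -> /= /(_ erefl).
Qed.

Lemma idem_corner p a :
  idem p ** (a ** idem p) = phi a (incidence_diag p) *: idem p.
Proof.
apply: phi_inj; apply/ffunP => w; rewrite linearZ phi_idem_mul !ffunE psiK ffunE.
rewrite -(inj_eq val_inj) incidence_diagE; case: eqP => wp; last by rewrite scaler0.
have -> : w = incidence_diag p by apply: val_inj; rewrite wp incidence_diagE.
by rewrite /GRing.scale /= mulr1.
Qed.

Lemma idem_idem p : idem p ** idem p = idem p.
Proof.
apply: phi_inj; apply/ffunP => w; rewrite phiM psiK incidence_mul_diagl ffunE.
by case: eqP => //; case: eqP => // -> /= /(_ erefl).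
Qed.

(** The transported idempotents sum to a left identity, so the character of [x] cannot vanish on all
    of them, and a nonzero value on an idempotent is 1. *)
Lemma supp_char_idem_exists x : exists p, supp_char x (idem p) = 1.
Proof.
have id1 : \sum_p idem p ** basis_elt K x = basis_elt K x.
  rewrite -semigroup_mul_suml; apply: phi_inj; rewrite phiM linear_sum /=.
  under eq_bigr do rewrite psiK.
  exact: incidence_sum_diag.
have : supp_char x (\sum_p idem p ** basis_elt K x) != 0.
  by rewrite id1 supp_char_basis supp_le_refl oner_eq0.
rewrite supp_char_sum => sum_neq0.
have [p /eqP xp] : exists p, supp_char x (idem p) != 0.
  apply/existsP; apply: contraNT sum_neq0; rewrite negb_exists => /forallP x0.
  apply/eqP/big1 => p _; rewrite supp_charM.
  by move/negPn/eqP: (x0 p) => ->; rewrite mul0r.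
exists p; apply: (mulfI (introN eqP xp)).
by rewrite mulr1 -supp_charM idem_idem.
Qed.

Lemma supp_char_corner x p a : supp_char x (idem p) = 1 ->
  supp_char x a = phi a (incidence_diag p).
Proof.
move=> xp; have := congr1 (supp_char x) (idem_corner p a).
by rewrite supp_charZ !supp_charM xp !mulr1 mul1r.
Qed.

(** Both characters are the diagonal coefficient at [p], hence equal; evaluating them at the basis
    elements of [x] and [y] compares the supports. *)
Lemma supp_char_idem x y p : supp_char x (idem p) = 1 ->
  supp_char y (idem p) != 0 -> supp_eq x y.
Proof.
move=> xp yp0; have yp : supp_char y (idem p) = 1.
  by apply: (mulfI yp0); rewrite mulr1 -supp_charM idem_idem.
have xyE a : supp_char x a = supp_char y a.
  by rewrite (supp_char_corner _ xp) (supp_char_corner _ yp).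
apply/andP; split.
  have := xyE (basis_elt K y); rewrite !supp_char_basis supp_le_refl.
  by case: supp_le => // /eqP; rewrite eq_sym oner_eq0.
have := xyE (basis_elt K x); rewrite !supp_char_basis supp_le_refl.
by case: supp_le => // /eqP; rewrite oner_eq0.
Qed.

End IncidenceIsomorphism.

(** * The projective modules of the semigroup algebra *)

Section WeightModules.
Variables (K : fieldType) (B : finLrbType).
Implicit Types (b c d w y z : B) (f g a : semigroup_algebra K B).

Local Notation "f ** g" := (semigroup_algebra_mul f g)
  (at level 40, left associativity).

Variables (x : B) (e : semigroup_algebra K B).
Hypothesis char_e : supp_char x e = 1.
Hypothesis char_neq0 : forall y, supp_char y e != 0 -> supp_eq x y.

(* Right multiplication by [e] is triangular for the support preorder. *)
Lemma mulr_coef_max a b : a ** e = a ->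
  (forall c, a c != 0 -> supp_le b c -> supp_le c b) ->
  a b = a b * supp_char b e.
Proof.
move=> ae bmax; rewrite -[in LHS]ae ffunE.
rewrite (bigD1 b) //= [X in _ + X]big1 ?addr0 => [|c cb].
  by rewrite /supp_char big_distrr.
apply: big1 => d /eqP cdb; have [->|ac] := eqVneq (a c) 0; first by rewrite mul0r.
have bc : supp_le b c by rewrite -cdb supp_mull.
case/eqP: cb; rewrite -cdb; apply/esym/supp_le_absorb.
by rewrite cdb bmax.
Qed.

Lemma max_supp_eq a b : a ** e = a -> a b != 0 ->
  (forall c, a c != 0 -> supp_le b c -> supp_le c b) -> supp_eq x b.
Proof.
move=> ae ab bmax; apply: char_neq0; apply: contra_neq ab => char_b.
by rewrite (mulr_coef_max ae bmax) char_b mulr0.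
Qed.

Lemma exists_max_supp a b : a b != 0 ->
  exists c, [/\ a c != 0, supp_le b c &
    forall d, a d != 0 -> supp_le c d -> supp_le d c].
Proof.
move=> ab; pose r c := #|[set d | supp_le d c]%SET|.
have [|c /andP[ac bc] cmax] := @arg_maxnP _ b (fun c => (a c != 0) && supp_le b c) r.
  by rewrite ab supp_le_refl.
exists c; split=> // d ad cd; apply: contraT => dc.
have : (r d <= r c)%N by apply: cmax; rewrite ad (supp_le_trans bc cd).
rewrite leqNgt => /negP[]; apply: proper_card; apply/properP; split.
  by apply/fintype.subsetP => u; rewrite !inE => uc; apply: supp_le_trans cd.
by exists d; rewrite inE // supp_le_refl.
Qed.

Lemma weight_support a b : a ** e = a -> a b != 0 -> supp_le b x.
Proof.
move=> ae /exists_max_supp[c [ac bc cmax]].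
have /andP[_ cx] := max_supp_eq ae ac cmax; exact: supp_le_trans cx.
Qed.

(** By [max_supp_eq], every maximal support occurring in [a] is that of [x], so [a] is determined by
    its coefficients on elements of that support. *)
Lemma weight_eq0 a : a ** e = a -> (forall w, supp_eq x w -> a w = 0) -> a = 0.
Proof.
move=> ae a0; apply/ffunP => b; rewrite [RHS]ffunE; apply/eqP/negPn/negP => ab.
have [c [ac _ cmax]] := exists_max_supp ab.
by have := ac; rewrite a0 ?eqxx // (max_supp_eq ae ac cmax).
Qed.

(** Products [b * c] lie under the support of [b], so none has the support of [x], and [weight_eq0]
    applies. *)
Lemma basis_mul_incomparable_eq0 a b : a ** e = a -> ~~ supp_le x b ->
  basis_elt K b ** a = 0.
Proof.
move=> ae xb; apply: weight_eq0 => [|w /andP[xw wx]].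
  by rewrite -semigroup_mulA ae.
rewrite basis_mulE; apply: big1 => c /eqP bcw; case/negP: xb.
by apply: supp_le_trans xw _; rewrite -bcw supp_mull.
Qed.

(** The only product [b * c] with the support of [x] is [b] itself, and its coefficient is the value
    of the character on [a]. *)
Lemma basis_mul_minimal_eq0 a b : a ** e = a -> supp_char x a = 0 ->
  supp_eq x b -> basis_elt K b ** a = 0.
Proof.
move=> ae xa xb; have /andP[lexb lebx] := xb.
apply: weight_eq0 => [|w /andP[xw wx]]; first by rewrite -semigroup_mulA ae.
rewrite basis_mulE; have [<-|wb] := eqVneq b w.
  by rewrite -[RHS]xa (supp_char_eq _ xb).
apply: big1 => c /eqP bcw; case/eqP: wb; rewrite -bcw; apply/esym/supp_le_absorb.
by rewrite bcw; apply: supp_le_trans xw.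
Qed.

(** For a basis element [b] of [f], either [y * b = y], which is the condition in [supp_char y], or
    [y * b] is a proper face of [y] and kills [a]. *)
Lemma basis_mul_weight y f a :
  (forall b, (y * b)%g = b -> b != y -> basis_elt K b ** a = 0) ->
  basis_elt K y ** (f ** a) = supp_char y f *: (basis_elt K y ** a).
Proof.
move=> ya; rewrite (semigroup_algebra_expand f) semigroup_mul_suml linear_sum.
rewrite supp_char_sum scaler_suml; apply: eq_bigr => b _.
rewrite semigroup_mul_scalel linearZ /= supp_charZ supp_char_basis.
rewrite -scalerA semigroup_mulA basis_mul; congr (_ *: _).
rewrite /supp_le; have [->|yb] := eqVneq; first by rewrite scale1r.
by rewrite scale0r ya // mulgA lrb_idem.
Qed.

Lemma basis_mul_cover y f a : a ** e = a -> supp_char x a = 0 ->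
  (forall b, (y * b)%g = b -> supp_le x b -> supp_le b x || (b == y)) ->
  basis_elt K y ** (f ** a) = supp_char y f *: (basis_elt K y ** a).
Proof.
move=> ae xa cover; apply: basis_mul_weight => b yb b_neq.
have [xb|xb] := boolP (supp_le x b); last exact: basis_mul_incomparable_eq0.
apply: basis_mul_minimal_eq0 => //; rewrite /supp_eq xb.
by have := cover b yb xb; rewrite (negPf b_neq) orbF.
Qed.

(** Modulo lower supports [e] is a right identity on such [u], because its character at [x] is 1; so
    multiplication by [e] is injective on them. *)
Lemma mulr_weight_coef (u : semigroup_algebra K B) w :
  (forall c, u c != 0 -> supp_eq x c) -> supp_eq x w -> (u ** e) w = u w.
Proof.
move=> ux xw; have /andP[lexw lewx] := xw.
rewrite ffunE (bigD1 w) //= [X in _ + X]big1 ?addr0 => [|c cw].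
  rewrite -big_distrr /= -[X in _ = X]mulr1 -char_e (supp_char_eq _ xw).
  by [].
apply: big1 => d /eqP cdw.
have [->|/ux/andP[xc cx]] := eqVneq (u c) 0; first by rewrite mul0r.
case/eqP: cw; rewrite -cdw; apply/esym/supp_le_absorb; rewrite cdw.
exact: supp_le_trans lexw.
Qed.

End WeightModules.

Lemma exists_nonzero_solution (K : fieldType) (I J : finType) (V : {set I})
    (M : J -> I -> K) : (#|J| < #|V|)%N ->
  exists u : I -> K, [/\ exists i, u i != 0, forall i, i \notin V -> u i = 0
    & forall j, \sum_i M j i * u i = 0].
Proof.
(* Vanishing outside [V] is imposed by further equations, one per index outside [V], so that a plain
   rank count over [I] suffices. *)
move=> JV; pose J' : finType := (J + {i | i \notin V})%type.
have J'I : (#|{: J'}| < #|I|)%N.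
  rewrite card_sum card_sig -(cardC [in V]) ltn_add2r.
  exact: JV.
pose M' (j : J') i : K := match j with inl j => M j i | inr k => (i == val k)%:R end.
pose A := \matrix_(i < #|I|, j < #|{: J'}|) M' (enum_val j) (enum_val i).
have /rowV0Pn[v /sub_kermxP vA v0] : kermx A != 0.
  rewrite -mxrank_eq0 mxrank_ker subn_eq0 -ltnNge.
  exact: leq_ltn_trans (rank_leq_col A) J'I.
have sol j : \sum_i M' j i * v ord0 (enum_rank i) = 0.
  have /rowP/(_ (enum_rank j)) := vA; rewrite mxE [in X in _ = X]mxE => vAj.
  rewrite -[RHS]vAj (reindex (@enum_val I predT)) /=; last first.
    by exists enum_rank => i _; rewrite ?enum_valK ?enum_rankK.
  by apply: eq_bigr => i _; rewrite !mxE enum_valK enum_rankK mulrC.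
exists (fun i => v ord0 (enum_rank i)); split=> [|i iV|j]; last exact: (sol (inl j)).
  have [k vk] : exists k, v ord0 k != 0.
    by apply/rV0Pn.
  by exists (enum_val k); rewrite enum_valK.
rewrite -[RHS](sol (inr (Sub i iV))) (bigD1 i) //= eqxx mul1r big1 ?addr0 //.
by move=> k ki; rewrite (negPf ki) mul0r.
Qed.

(** * Corners of kB and vertices below a face *)

Section IncidenceIsomorphismIntervals.
Variables (K : fieldType) (B : finLrbType) (d : Order.disp_t) (P : finPOrderType d).
Local Notation kB := (semigroup_algebra K B).
Variable phi : {linear kB -> incidence_algebra K P}.
Hypothesis phiM : {morph phi : f g /
  semigroup_algebra_mul f g >-> incidence_algebra_mul f g}.
Variable psi : incidence_algebra K P -> kB.
Hypothesis phiK : cancel phi psi.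
Hypothesis psiK : cancel psi phi.
Implicit Types (f g a : kB) (p q : P) (x y z b v w : B).

Local Notation "f ** g" := (semigroup_algebra_mul f g)
  (at level 40, left associativity).
Local Notation idem := (idem psi).

(** Under the CW hypothesis these are two points when [y] covers [x], and the vertices of a circle
    when the rank is 2. *)
Definition minimal_faces x y : {set B} := [set v | (y * v == v)%g && supp_eq x v]%SET.

Let char_neq0 x p : supp_char x (idem p) = 1 ->
  forall y, supp_char y (idem p) != 0 -> supp_eq x y.
Proof. by move=> xp y; exact: supp_char_idem. Qed.

(** With more vertices, some nonzero combination [u] solves the linear system below. Then [a], the
    product of [u] and [idem p], is fixed by [idem q] followed by [y], whereas [idem q] kills it.
    The last hypothesis lets each [z] take at most two values on the vertices. *)
Lemma card_minimal_faces_le x y p q (M : {set B}) :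
  supp_char x (idem p) = 1 -> supp_char y (idem q) = 1 ->
  (forall b, (y * b)%g = b -> b != y -> supp_le x b ->
     supp_le b x \/ exists2 z, z \in M & supp_le b z) ->
  (forall z, z \in M -> {in minimal_faces x y & &, forall v0 v v',
     (z * v)%g != (z * v0)%g -> (z * v')%g != (z * v0)%g -> (z * v = z * v')%g}) ->
  (#|minimal_faces x y| <= #|M| + 2)%N.
Proof.
move=> xp yq faces ends; set V := minimal_faces x y.
have [->|[v0 v0V]] := finset.set_0Vmem V; first by rewrite cards0.
rewrite leqNgt; apply/negP => VM.
pose J : finType := option (option {z | z \in M}).
(* The equations: zero augmentation; zero coefficient at the pair [(p, q)], trivial if [p <= q]
   fails; for each [z], zero sum over the vertices with the same image as [v0]. *)
pose D (j : J) b : K := match j with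
  | None => 1
  | Some None => if insub (p, q) is Some w then phi (basis_elt K b) w else 0
  | Some (Some z) => ((val z * b)%g == (val z * v0)%g)%:R end.
have [|u0 [[b0 ub0] uV sol]] := @exists_nonzero_solution K B J V D.
  by rewrite !card_option card_sig -addn2.
pose u : kB := [ffun b => u0 b]; have uE b : u b = u0 b by rewrite ffunE.
have {}uV b : u b != 0 -> b \in V.
  by apply: contraNT => bV; rewrite uE uV.
have ux b : u b != 0 -> supp_eq x b by move=> /uV; rewrite inE => /andP[].
have yu : basis_elt K y ** u = u.
  rewrite (semigroup_algebra_expand u) linear_sum; apply: eq_bigr => b _.
  rewrite linearZ /= basis_mul; have [->|/uV] := eqVneq (u b) 0.
    by rewrite !scale0r.
  by rewrite inE => /andP[/eqP-> _].
pose e := idem p; pose a := u ** e.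
have ae : a ** e = a by rewrite /a -semigroup_mulA (idem_idem phiM phiK psiK).
have xa : supp_char x a = 0.
  rewrite /a supp_charM xp mulr1 -[RHS](sol None) /supp_char big_mkcond.
  apply: eq_bigr => b _ /=; rewrite mul1r -uE; case: ifP => // xb.
  by apply/esym/eqP; apply: contraFT xb => /ux/andP[].
have zu z : z \in M -> basis_elt K z ** u = 0.
  move=> zM; apply/ffunP => w; rewrite basis_mulE [RHS]ffunE.
  have sum0 : \sum_(c | (z * c == z * v0)%g) u c = 0.
    rewrite -[RHS](sol (Some (Some (Sub z zM)))) big_mkcond /=.
    by apply: eq_bigr => c _; rewrite uE; case: eqP; rewrite ?mul1r ?mul0r.
  have [->//|wv0] := eqVneq w (z * v0)%g.
  have [c /andP[cV /eqP zc]|noc] := pickP (fun c => (c \in V) && (z * c == w)%g).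
    (* One equation per [z] is enough: the remaining vertices share a single image, whose
       coefficient vanishes with the augmentation. *)
    have sum1 : \sum_c u c = 0.
      rewrite -[RHS](sol None); apply: eq_bigr => b _.
      by rewrite /= mul1r uE.
    move: sum1; rewrite (bigID (fun c => z * c == z * v0)%g) /= sum0 add0r => sum1.
    rewrite -[RHS]sum1 big_mkcond [RHS]big_mkcond; apply: eq_bigr => b _.
    have [->|/uV bV] := eqVneq (u b) 0; first by rewrite !if_same.
    congr (if _ then _ else _); rewrite -zc; apply/eqP/idP => [->|zb].
      by rewrite zc.
    by apply: (ends z zM v0 b c) => //; rewrite zc.
  apply: big1 => c zc; apply/eqP/negPn/negP => /uV cV.
  by have := noc c; rewrite cV zc.
(* Every [b] below [y] other than [y] kills [a]: by incomparability with [x], by the augmentation if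
   it is a vertex, or through [b = b * z] with [z] in [M]. So [y] kB acts by the character of [y],
   which is 1 on [idem q]. *)
have ya : basis_elt K y ** (idem q ** a) = basis_elt K y ** a.
  rewrite (basis_mul_weight (y := y)) ?yq ?scale1r // => b yb b_neq.
  have [xb|xb] := boolP (supp_le x b); last first.
    exact: (basis_mul_incomparable_eq0 (char_neq0 xp) ae xb).
  have [bx|[z zM /eqP bz]] := faces b yb b_neq xb.
    by apply: (basis_mul_minimal_eq0 (char_neq0 xp)) => //; rewrite /supp_eq xb.
  rewrite /a semigroup_mulA -bz -basis_mul -(semigroup_mulA _ _ u) zu //.
  by rewrite linear0 semigroup_mul0l.
have qa : idem q ** a = 0.
  apply: (idem_mul_coef_eq0 phiM phiK psiK) => w wpq.
  rewrite (semigroup_algebra_expand u) linear_sum sum_ffunE.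
  rewrite -[RHS](sol (Some None)); apply: eq_bigr => b _.
  rewrite linearZ ffunE /= -uE /GRing.scale /= mulrC.
  by rewrite -wpq valK.
have := mulr_weight_coef xp ux (ux b0 _); rewrite uE => /(_ ub0).
have -> : u ** e = 0.
  by rewrite -/a /a -yu -semigroup_mulA -/a -ya qa linear0.
by rewrite ffunE => /esym/eqP; rewrite (negPf ub0).
Qed.

(** The difference of two vertices, times [idem p], is a nonzero element fixed by [idem q] followed
    by [y]; so the corner from [p] to [q] is nonzero. *)
Lemma cover_le x y p q v w :
  supp_char x (idem p) = 1 -> supp_char y (idem q) = 1 ->
  (forall b, (y * b)%g = b -> supp_le x b -> supp_le b x || (b == y)) ->
  v \in minimal_faces x y -> w \in minimal_faces x y -> v != w -> (p <= q)%O.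
Proof.
move=> xp yq cover; rewrite !inE => /andP[/eqP yv xv] /andP[/eqP yw xw] vw.
pose u : kB := basis_elt K v - basis_elt K w; pose a := u ** idem p.
have ae : a ** idem p = a.
  by rewrite /a -semigroup_mulA (idem_idem phiM phiK psiK).
have ux b : u b != 0 -> supp_eq x b.
  rewrite !ffunE; have [->//|_] := eqVneq b v; have [->//|_] := eqVneq b w.
  by rewrite subrr eqxx.
have xa : supp_char x a = 0.
  rewrite /a supp_charM /u supp_charB !supp_char_basis.
  have /andP[-> _] := xv; have /andP[-> _] := xw.
  by rewrite subrr mul0r.
have ya : basis_elt K y ** a = a.
  by rewrite /a semigroup_mulA linearB /= !basis_mul yv yw.
have := basis_mul_cover (char_neq0 xp) (idem q) ae xa cover.
rewrite yq scale1r ya => yqa; apply: contraT => pq.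
have a0 : a = 0.
  by rewrite -yqa /a (idem_mul_eq0 phiM phiK psiK) ?linear0.
have := mulr_weight_coef xp ux xv; rewrite -/a a0 !ffunE eqxx (negPf vw) subr0.
by move=> /esym/eqP; rewrite oner_eq0.
Qed.

(** A nonzero [a] in the corner is killed by [z], as the character of [z] vanishes on [idem q]. If
    all vertices below [y] were below [z], then [y] and [z] would act alike on [a], so [y] would
    kill it too; but the corner of [y] at [idem q] is [idem q] itself, which fixes [a]. *)
Lemma minimal_faces_not_all_below x y p q z :
  supp_char x (idem p) = 1 -> supp_char y (idem q) = 1 -> (p <= q)%O ->
  supp_le x y -> ~~ supp_le y z -> ~~ supp_le y x -> (y * z)%g = z ->
  (forall b, (z * b)%g = b -> supp_le x b -> supp_le b x || (b == z)) ->
  exists2 v, v \in minimal_faces x y & (z * v)%g != v.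
Proof.
move=> xp yq pq xy yz yx yzz cover; apply/exists_inP.
apply: contraT; rewrite negb_exists => /forallP zV.
have {}zV v : v \in minimal_faces x y -> (z * v)%g = v.
  by move=> vV; have := zV v; rewrite vV negbK => /eqP.
have zy : (z * y)%g = z by rewrite -{1}yzz lrb_xyx.
have [a [a0 qa ap]] := idem_mul_line phiM phiK psiK pq.
have nchar y' : ~~ supp_le y y' -> supp_char y' (idem q) = 0.
  move=> yy'; apply/eqP; apply: contraNT yy' => /(char_neq0 yq) /andP[].
  by [].
have xa : supp_char x a = 0 by rewrite -qa supp_charM nchar ?mul0r.
have za : basis_elt K z ** a = 0.
  rewrite -qa (basis_mul_cover (char_neq0 xp) _ ap xa cover).
  by rewrite nchar // scale0r.
have ya : basis_elt K y ** a = 0.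
  rewrite -[RHS]za; apply/eqP; rewrite -subr_eq0 -semigroup_mulBl; apply/eqP.
  apply: (weight_eq0 (char_neq0 xp)).
    by rewrite -semigroup_mulA ap.
  move=> w /andP[xw wx]; rewrite semigroup_mulBl ffunE [X in _ + X]ffunE.
  rewrite !basis_mulE; apply/eqP; rewrite subr_eq0; apply/eqP.
  rewrite big_mkcond [RHS]big_mkcond; apply: eq_bigr => c _.
  have [->|ac] := eqVneq (a c) 0; first by rewrite !if_same.
  have cx := weight_support (char_neq0 xp) ap ac.
  congr (if _ then _ else _); apply/eqP/eqP => [ycw|zcw].
    have wV : w \in minimal_faces x y.
      by rewrite inE /supp_eq xw wx andbT -ycw mulgA lrb_idem eqxx.
    by rewrite -(zV w wV) -ycw mulgA zy.
  rewrite -zcw -[in RHS]zy -mulgA [RHS]zV //; rewrite inE mulgA lrb_idem eqxx /=.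
  rewrite /supp_eq supp_le_mul xy (supp_le_trans xw) -?zcw ?supp_mulr //=.
  exact: supp_le_trans (supp_mulr y c) cx.
have : idem q ** (basis_elt K y ** idem q) = idem q.
  have := idem_corner phiM phiK psiK q (basis_elt K y).
  rewrite -(supp_char_corner phiM phiK psiK _ yq) supp_char_basis.
  by rewrite supp_le_refl scale1r.
move/(congr1 (fun f => f ** a)); rewrite -!semigroup_mulA qa ya linear0.
by move=> /esym/eqP; rewrite (negPf a0).
Qed.

End IncidenceIsomorphismIntervals.

(** * Faces over an interval of rank 2 *)

Lemma order_complex_pair (d : Order.disp_t) (T : finPOrderType d) (A : {set T}) v e :
  v \in A -> e \in A -> (v <= e)%O -> [set v; e]%SET \in order_complex A.
Proof.
move=> vA eA ve; rewrite inE; apply/and3P; split.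
- by apply/fintype.subsetP => u; rewrite !inE => /orP[] /eqP->.
- by apply/finset.set0Pn; exists v; rewrite !inE eqxx.
apply/'forall_implyP => a; rewrite !inE => a_in.
apply/'forall_implyP => b; rewrite !inE => /orP[]/eqP->;
  by case/orP: a_in => /eqP->;
    rewrite ?comparablexx ?(le_comparable ve) ?(ge_comparable ve).
Qed.

Lemma chain_comparable (d : Order.disp_t) (T : finPOrderType d) (s : {set T}) a b :
  is_chain s -> a \in s -> b \in s -> (a >=< b)%O.
Proof. by move=> /'forall_implyP sP aS bS; exact: ('forall_implyP (sP a aS)) b bS. Qed.

Lemma mem_below (d : Order.disp_t) (T : finPOrderType d) (A : {set T}) p v :
  (v \in below A p) = (v \in A) && (v <= p)%O.
Proof. by rewrite inE. Qed.

Lemma mem_strictly_below (d : Order.disp_t) (T : finPOrderType d) (A : {set T}) p v :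
  (v \in strictly_below A p) = (v \in A) && (v < p)%O.
Proof. by rewrite inE. Qed.

Section LrbFaces.
Variables (R : realType) (B : finLrbType).
Hypothesis B_CW : CW_lrb B R.
Implicit Types (a b v e x y z : B).

Lemma lrb_leE (a b : lrb_order B) : (a <= b)%O = (b * a == a :> B)%g.
Proof. by []. Qed.

Lemma mem_lrb_ge x b : (b \in lrb_ge (left_ideal x)) = supp_le x b.
Proof. by rewrite inE left_ideal_le. Qed.

Lemma lrb_le_supp (a b : lrb_order B) : (a <= b)%O -> supp_le a b.
Proof. by rewrite lrb_leE => /eqP <-; exact: supp_mull. Qed.

Lemma lrb_le_eq (a b : lrb_order B) : (a <= b)%O -> supp_le b a -> a = b.
Proof. by rewrite lrb_leE => /eqP ba /eqP; rewrite ba. Qed.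

Lemma supp_eq_comparable (a b : lrb_order B) : supp_eq a b -> (a >=< b)%O -> a = b.
Proof.
move=> /andP[ab ba] /orP[le_ab|le_ba]; first exact: lrb_le_eq.
by apply/esym; apply: lrb_le_eq.
Qed.

Lemma CW_sphere x y n : supp_le x y ->
  complex_dim (order_complex (below (lrb_ge (left_ideal x)) (y : lrb_order B))) = n ->
  homeomorphic
    (realization R
      (order_complex (strictly_below (lrb_ge (left_ideal x)) (y : lrb_order B))))
    (unit_sphere R n).
Proof.
move=> xy <-; have [|_] := B_CW (X := left_ideal x); first by apply: imset_f.
by apply; rewrite mem_lrb_ge.
Qed.

Lemma complex_dimE (V : finType) (C : {set {set V}}) n s :
  s \in C -> #|s| = n.+1 -> (forall t, t \in C -> (#|t| <= n.+1)%N) ->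
  complex_dim C = n.
Proof.
move=> sC sn Cn; suff -> : complex_dim C = n.+1.-1 by [].
congr _.-1; apply/eqP; rewrite eqn_leq -{2}sn.
rewrite (@leq_bigmax_cond _ (mem C) (fun t => #|t|) s sC) andbT.
by apply/bigmax_leqP.
Qed.

Lemma minimal_face_mul x y v : supp_le x y -> supp_eq x v ->
  (y * v)%g \in minimal_faces x y.
Proof.
move=> xy /andP[xv vx]; rewrite inE mulgA lrb_idem eqxx /supp_eq.
by rewrite supp_le_mul xy xv; apply: supp_le_trans (supp_mulr y v) vx.
Qed.

Lemma minimal_face_neq x y v : ~~ supp_le y x -> v \in minimal_faces x y -> v != y.
Proof. by rewrite inE => yx /andP[_ /andP[_ vx]]; apply: contraNneq yx => <-. Qed.

(** Comparable elements of equal support coincide. *)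
Lemma card_chain_supp_eq (s : {set lrb_order B}) : is_chain s ->
  {in s &, forall a b, supp_eq a b} -> (#|s| <= 1)%N.
Proof.
move=> sC seq; apply/card_le1_eqP => a b aS bS.
by apply: supp_eq_comparable; [exact: seq | exact: chain_comparable sC _ _].
Qed.

(** The proper faces of [y] are all vertices, so the complex below [y] has dimension 1 and its
    boundary is a 0-sphere. *)
Lemma card_cover_faces x y : supp_le x y -> ~~ supp_le y x ->
  (forall b, (y * b)%g = b -> supp_le x b -> supp_le b x || (b == y)) ->
  #|minimal_faces x y| = 2%N.
Proof.
move=> xy yx cover; set A := lrb_ge (left_ideal x).
have VE : strictly_below A (y : lrb_order B) = minimal_faces x y.
  apply/setP => b; rewrite mem_strictly_below mem_lrb_ge lt_neqAle lrb_leE [RHS]inE.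
  apply/and3P/andP => [[xb b_neq /eqP yb]|[/eqP yb xb]].
    rewrite yb eqxx /supp_eq xb; split=> //.
    by have := cover b yb xb; rewrite (negPf b_neq) orbF.
  have /andP[-> _] := xb; rewrite yb eqxx; split=> //.
  by apply: (minimal_face_neq yx); rewrite inE yb eqxx.
suff card2 : #|strictly_below A (y : lrb_order B)| = 2%N by rewrite -card2 VE.
apply: (@card_sphere0 R); apply: CW_sphere => //.
(* This vertex makes the dimension 1 rather than 0. *)
pose v : lrb_order B := (y * x)%g.
have vV : v \in minimal_faces x y.
  by apply: minimal_face_mul; rewrite // /supp_eq supp_le_refl.
have : v \in strictly_below A (y : lrb_order B) by rewrite VE.
rewrite mem_strictly_below => /andP[vA vy].
apply: (@complex_dimE _ _ 1 [set v; y]%SET).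
- have yA : (y : lrb_order B) \in A by rewrite mem_lrb_ge.
  by apply: order_complex_pair; rewrite ?mem_below ?vA ?yA ?lexx ?ltW.
- by rewrite cards2 (minimal_face_neq yx vV).
move=> s; rewrite inE => /and3P[/fintype.subsetP sB _ sC].
rewrite (cardsD1 y) -addn1 addnC leq_add ?leq_b1 //.
have sx b : b \in (s :\ y)%SET -> supp_eq x b.
  rewrite !inE => /andP[b_neq /sB]; rewrite mem_below mem_lrb_ge => /andP[xb].
  rewrite lrb_leE => /eqP /cover /(_ xb).
  by rewrite (negPf b_neq) orbF /supp_eq xb.
apply: card_chain_supp_eq => [|a b /sx/andP[xa ax] /sx/andP[xb bx]].
  apply/'forall_implyP => a /setD1P[_ aS]; apply/'forall_implyP => b /setD1P[_ bS].
  exact: chain_comparable sC _ _.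
by rewrite /supp_eq (supp_le_trans ax xb) (supp_le_trans bx xa).
Qed.

(** * Vertices and edges over an interval of rank 2 *)

Section RankTwo.
Variables x y : B.
Hypothesis xy : supp_le x y.
Hypothesis rank2 : complex_dim (order_complex
  (order_interval (Lambda B) (left_ideal x) (left_ideal y))) = 2%N.

Let I := order_interval (Lambda B) (left_ideal x) (left_ideal y).

Let mem_I z : (left_ideal z \in I) = supp_le x z && supp_le z y.
Proof. by rewrite inE !left_ideal_le imset_f. Qed.

Let max_chain : (\max_(s in order_complex I) #|s|)%N = 3%N.
Proof.
(* [complex_dim] is a truncated predecessor; the value 2 excludes the truncation. *)
by move: rank2; rewrite /complex_dim -/I; case: (\max_(s in _) _)%N => //= n ->.
Qed.

Definition middle : {set {set B}} := (I :\ left_ideal x :\ left_ideal y)%SET.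

Lemma middleP z : (left_ideal z \in middle) =
  [&& supp_le x z, ~~ supp_le z x, supp_le z y & ~~ supp_le y z].
Proof.
rewrite !in_setD1 mem_I !left_ideal_eq /supp_eq.
by do 4!case: supp_le.
Qed.

Lemma middle_rep Z : Z \in middle -> exists z, Z = left_ideal z.
Proof. by rewrite !inE => /and3P[_ _ /andP[/imsetP[z _ ->] _]]; exists z. Qed.

(** Otherwise the two ends and the two middle elements form a chain of four elements, while
    [max_chain] allows three. *)
Lemma middle_antichain a b : left_ideal a \in middle -> left_ideal b \in middle ->
  supp_le a b -> supp_le b a.
Proof.
rewrite !middleP => /and4P[xa ax ay ya] /and4P[xb bx by_ yb] ab.
apply: contraT => ba.
pose s := [set left_ideal x; left_ideal a; left_ideal b; left_ideal y]%SET.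
have sC : s \in order_complex I.
  rewrite inE; apply/and3P; split.
  - apply/fintype.subsetP => Z; rewrite !finset.in_setU !finset.in_set1 -!orbA.
    by case/or4P => /eqP->; rewrite mem_I ?supp_le_refl ?xy ?xa ?xb.
  - by apply/finset.set0Pn; exists (left_ideal x); rewrite !inE eqxx.
  apply/'forall_implyP => Z; rewrite !finset.in_setU !finset.in_set1 -!orbA => Zs.
  apply/'forall_implyP => W; rewrite !finset.in_setU !finset.in_set1 -!orbA => Ws.
  rewrite /Order.comparable.
  by case/or4P: Zs => /eqP->; case/or4P: Ws => /eqP->;
    rewrite !left_ideal_le ?supp_le_refl ?xy ?xa ?xb ?ab ?ay ?by_ ?orbT.
have : (#|s| <= 3)%N.
  by rewrite -max_chain (@leq_bigmax_cond _ (mem (order_complex I)) (fun t => #|t|)).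
rewrite /s finset.setUC cardsU1 finset.setUC cardsU1 cards2.
rewrite !inE !left_ideal_eq /supp_eq.
rewrite (negPf ax) (negPf ba) (negPf ya) (negPf yb) (negPf bx) ?andbF ?orbF ?andFb /=.
by have /negPf-> : ~~ supp_le y x by apply: contra bx; exact: supp_le_trans by_.
Qed.

Lemma middle_neq0 : (0 < #|middle|)%N.
Proof.
have [|s sC s3] := @eq_bigmax_cond _ (mem (order_complex I)) (fun t => #|t|).
  rewrite lt0n; apply/eqP => C0; move: max_chain.
  by rewrite big_pred0 // => s; move/card0_eq: C0 => /(_ s).
have {}s3 : #|s| = 3%N by rewrite -max_chain s3.
have : s \in order_complex I by [].
rewrite inE => /and3P[sI _ _].
have : (#|s :\ left_ideal x :\ left_ideal y|%SET <= #|middle|)%N.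
  by apply: subset_leq_card; rewrite !finset.setSD.
apply: leq_trans.
have := s3; rewrite (cardsD1 (left_ideal x)) (cardsD1 (left_ideal y) (_ :\ _)%SET).
by case: (left_ideal x \in s); case: (left_ideal y \in _); case: #|_|.
Qed.

Lemma not_supp_le_yx : ~~ supp_le y x.
Proof.
have /card_gt0P[Z Zm] := middle_neq0; have [z zE] := middle_rep Zm.
move: Zm; rewrite zE middleP => /and4P[_ + zy _]; apply: contra => yx.
exact: supp_le_trans zy yx.
Qed.

Lemma card_interval : #|I| = (#|middle| + 2)%N.
Proof.
rewrite (cardsD1 (left_ideal x)) (cardsD1 (left_ideal y) (_ :\ _)%SET) -/middle.
rewrite mem_I supp_le_refl xy in_setD1 mem_I supp_le_refl xy.
by rewrite left_ideal_eq /supp_eq (negPf not_supp_le_yx) /= !add1n addn2.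
Qed.

Definition edges : {set B} :=
  [set e | (y * e == e)%g && (left_ideal e \in middle)]%SET.

(** An element strictly between would give a middle support strictly below that of [e], against
    [middle_antichain]. *)
Lemma lower_cover e : e \in edges ->
  forall b, (e * b)%g = b -> supp_le x b -> supp_le b x || (b == e).
Proof.
rewrite inE => /andP[_ em] b eb xb; have [//|bx] := boolP (supp_le b x).
have be : supp_le b e by rewrite -eb supp_mull.
apply/eqP; move: (em); rewrite middleP => /and4P[_ _ ey ye].
suff : supp_le e b by move/eqP; rewrite eb.
apply: middle_antichain (be) => //; rewrite middleP xb bx (supp_le_trans be ey).
by apply: contra ye => yb; exact: supp_le_trans be.
Qed.

Lemma upper_cover z : left_ideal z \in middle ->
  forall b, (y * b)%g = b -> supp_le z b -> supp_le b z || (b == y).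
Proof.
move=> zm b yb zb; have [//|bz] := boolP (supp_le b z).
have by_ : supp_le b y by rewrite -yb supp_mull.
apply/eqP; have [/eqP|yb'] := boolP (supp_le y b); first by rewrite yb.
case/negP: bz; apply: middle_antichain (zb) => //.
move: zm; rewrite !middleP => /and4P[xz zx zy yz].
rewrite (supp_le_trans xz zb) by_ yb' !andbT /=.
by apply: contra zx; apply: supp_le_trans.
Qed.

Lemma card_faces_edge e : e \in edges -> #|minimal_faces x e| = 2%N.
Proof.
move=> eE; have := eE; rewrite inE middleP => /and5P[_ xe ex _ _].
by apply: card_cover_faces => //; exact: lower_cover.
Qed.

Lemma card_faces_middle z : left_ideal z \in middle -> #|minimal_faces z y| = 2%N.
Proof.
move=> zm; have := zm; rewrite middleP => /and4P[_ _ zy yz].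
by apply: card_cover_faces => //; exact: upper_cover.
Qed.

(** Edges are sorted by support: those over a middle [z] form [minimal_faces z y]. *)
Lemma card_edges : #|edges| = (#|middle| * 2)%N.
Proof.
rewrite -sum1_card (partition_big (@left_ideal B) (mem middle)) /=; last first.
  by move=> e; rewrite inE => /andP[].
rewrite -sum_nat_const; apply: eq_bigr => Z Zm; have [z zE] := middle_rep Zm.
rewrite -(card_faces_middle (z := z)) -?zE // -sum1_card; apply: eq_bigl => e.
rewrite [in LHS]inE [RHS]inE -left_ideal_eq -zE [Z == _]eq_sym.
by have [->|_] := eqVneq (left_ideal e) Z; rewrite ?Zm ?andbT ?andbF.
Qed.

Let A := lrb_ge (left_ideal x).

Lemma mem_strictly_below_lrb (b : lrb_order B) :
  (b \in strictly_below A (y : lrb_order B)) =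
  (b \in minimal_faces x y) || (b \in edges).
Proof.
rewrite mem_strictly_below mem_lrb_ge lt_neqAle lrb_leE [X in _ = X || _]inE.
rewrite [X in _ = _ || X]inE -andb_orr middleP /supp_eq.
have [yb|_] := eqVneq (y * b)%g b; last by rewrite !andbF.
have by_ : supp_le b y by rewrite -yb supp_mull.
have yb_eq : supp_le y b = (b == y).
  by apply/idP/eqP => [/eqP|->]; [rewrite yb | exact: supp_le_refl].
rewrite by_ yb_eq /= andbT.
have [->|_] := eqVneq b y; last by case: supp_le; case: supp_le.
by rewrite (negPf not_supp_le_yx) !andbF.
Qed.

Lemma minimal_face_edge_lt (v e : lrb_order B) : v \in minimal_faces x e ->
  e \in edges -> v \in minimal_faces x y.
Proof.
rewrite !inE => /andP[/eqP ev ->] /andP[/eqP ye _].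
by rewrite -ev mulgA ye eqxx.
Qed.

Lemma chain_subset (s t : {set lrb_order B}) : is_chain s -> t \subset s -> is_chain t.
Proof.
move=> sC /fintype.subsetP ts; apply/'forall_implyP => a /ts aS.
by apply/'forall_implyP => b /ts bS; exact: chain_comparable sC _ _.
Qed.

Lemma exists_flag : exists v e : B, e \in edges /\ v \in minimal_faces x e.
Proof.
have /card_gt0P[e eE] : (0 < #|edges|)%N by rewrite card_edges muln_gt0 middle_neq0.
have /card_gt0P[v vV] : (0 < #|minimal_faces x e|)%N by rewrite card_faces_edge.
by exists v, e.
Qed.

(** This makes the CW hypothesis at [y] speak of a circle. A flag gives dimension at least 2;
    besides [y], a chain has at most one vertex and one edge. *)
Lemma complex_dim_below : complex_dim (order_complex (below A (y : lrb_order B))) = 2%N.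
Proof.
have [v0 [e0 [eE vV]]] := exists_flag.
pose v : lrb_order B := v0; pose e : lrb_order B := e0.
have : v \in strictly_below A (y : lrb_order B).
  by rewrite mem_strictly_below_lrb (minimal_face_edge_lt vV eE).
rewrite mem_strictly_below => /andP[vA vy].
have : e \in strictly_below A (y : lrb_order B).
  by rewrite mem_strictly_below_lrb orbC eE.
rewrite mem_strictly_below => /andP[eA ey].
have yA : (y : lrb_order B) \in A by rewrite mem_lrb_ge.
have ve : (v < e)%O.
  rewrite lt_neqAle lrb_leE; move: (vV); rewrite inE => /andP[-> _].
  rewrite andbT; apply: minimal_face_neq vV.
  by move: eE; rewrite inE middleP => /and5P[].
apply: (@complex_dimE _ _ 2 [set v; e; (y : lrb_order B)]%SET).
- rewrite inE; apply/and3P; split.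
  + apply/fintype.subsetP => b; rewrite !finset.in_setU !finset.in_set1 mem_below -orbA.
    by case/or3P => /eqP->; rewrite ?vA ?eA ?yA ?lexx ?ltW.
  + by apply/finset.set0Pn; exists v; rewrite !inE eqxx.
  apply/'forall_implyP => a; rewrite !finset.in_setU !finset.in_set1 -orbA => a_in.
  apply/'forall_implyP => b; rewrite !finset.in_setU !finset.in_set1 -orbA => b_in.
  rewrite /Order.comparable.
  by case/or3P: a_in => /eqP->; case/or3P: b_in => /eqP->;
    rewrite ?lexx ?(ltW ve) ?(ltW vy) ?(ltW ey) ?orbT.
- rewrite finset.setUC cardsU1 cards2 !inE (lt_eqF ve).
  by rewrite !(eq_sym (y : lrb_order B)) (lt_eqF vy) (lt_eqF ey).
move=> s; rewrite inE => /and3P[/fintype.subsetP sB _ sC].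
have sy b : b \in (s :\ y)%SET -> (b \in minimal_faces x y) || (b \in edges).
  rewrite -mem_strictly_below_lrb mem_strictly_below in_setD1 => /andP[b_neq /sB].
  by rewrite mem_below lt_neqAle b_neq.
rewrite (cardsD1 (y : lrb_order B)) -(cardsID (minimal_faces x y) (_ :\ _)%SET).
rewrite addnA -[3%N]/(1 + 1 + 1)%N; apply: leq_add; first apply: leq_add.
- exact: leq_b1.
- apply: card_chain_supp_eq => [|a b].
    by apply: chain_subset sC _; rewrite finset.subIset // subsetDl.
  rewrite ![_ \in (_ :&: _)%SET]inE => /andP[_ aV] /andP[_ bV].
  move: aV bV; rewrite !inE => /and3P[_ xa ax] /and3P[_ xb bx].
  by rewrite /supp_eq (supp_le_trans ax xb) (supp_le_trans bx xa).
apply: card_chain_supp_eq => [|a b].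
  by apply: chain_subset sC _; rewrite finset.subDset finset.subsetU // subsetDl orbT.
have sE c : c \in (s :\ y :\: minimal_faces x y)%SET -> c \in s /\ c \in edges.
  rewrite inE => /andP[cV cs]; have := sy c cs; rewrite (negPf cV).
  by move: cs; rewrite inE => /andP[].
move=> /sE[aS]; rewrite inE => /andP[_ am] /sE[bS]; rewrite inE => /andP[_ bm].
have [/lrb_le_supp ab|/lrb_le_supp ba] := orP (chain_comparable sC aS bS).
  by rewrite /supp_eq ab (middle_antichain am bm).
by rewrite /supp_eq ba andbT (middle_antichain bm am).
Qed.

(** At most two by [circle_card_link]. With at most one edge at [v], all faces through [v] would lie
    in one segment, against [circle_no_end]. *)
Lemma card_edges_above v : v \in minimal_faces x y ->
  #|[set e in edges | (e * v == v)%g]%SET| = 2%N.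
Proof.
move=> vV; set N := finset _.
have sphere := CW_sphere xy complex_dim_below.
set C := order_complex _ in sphere.
pose v' : lrb_order B := v.
have vC : v' \in strictly_below A (y : lrb_order B).
  by rewrite mem_strictly_below_lrb vV.
have pairC (e : lrb_order B) : e \in N -> [set v'; e]%SET \in C.
  rewrite inE => /andP[eE ev]; apply: order_complex_pair => //.
  by rewrite mem_strictly_below_lrb eE orbT.
have v1C : [set v']%SET \in C.
  by rewrite -[[set v']%SET]finset.setUid; exact: order_complex_pair.
have vN : v \notin N.
  rewrite inE [v \in edges]inE middleP; move: vV; rewrite inE => /and3P[_ _ ->].
  by rewrite !andbF.
apply/eqP; rewrite eqn_leq; apply/andP; split.
  exact: (circle_card_link sphere v1C (N := N : {set lrb_order B}) pairC vN).
rewrite ltnNge; apply/negP => /card_le1_eqP N1.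
(* If no edge contains [v], the vertex itself serves as [e]. *)
have [e Ne] : exists e : lrb_order B, forall u, u \in N -> u = e.
  have [->|[e eN]] := finset.set_0Vmem N; first by exists v' => u; rewrite inE.
  by exists e => u uN; apply: N1.
apply: (circle_no_end sphere v1C (e := e)) => s.
rewrite inE => /and3P[/fintype.subsetP sA _ sC] vs.
apply/fintype.subsetP => u us; rewrite !inE; have [//|uv] := eqVneq u v'.
apply/eqP/Ne; have := sA u us; rewrite mem_strictly_below_lrb.
have uV : u \notin minimal_faces x y.
  apply: contra_neqN uv; rewrite inE => /andP[_ /andP[xu ux]].
  apply: supp_eq_comparable; last exact: chain_comparable sC _ _.
  move: vV; rewrite inE => /and3P[_ xv vx].
  by rewrite /supp_eq (supp_le_trans ux xv) (supp_le_trans vx xu).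
rewrite (negPf uV) /= => uE; rewrite finset.in_set uE /=.
have [uv'|//] := orP (chain_comparable sC us vs).
move: uE; rewrite inE middleP => /and5P[_ _ /negP[]].
apply: supp_le_trans (lrb_le_supp uv') _.
by move: vV; rewrite inE => /and3P[].
Qed.

(** Flags are counted in two ways: each vertex lies on two edges and each edge has two vertices. *)
Lemma card_vertices : #|minimal_faces x y| = (#|middle| * 2)%N.
Proof.
rewrite -card_edges; apply/eqP; rewrite -(eqn_pmul2r (isT : 0 < 2)%N); apply/eqP.
rewrite -!sum_nat_const.
transitivity (\sum_(v in minimal_faces x y) \sum_(e in edges | (e * v == v)%g) 1)%N.
  apply: eq_bigr => v vV; rewrite -(card_edges_above vV) -sum1_card.
  by apply: eq_bigl => e; rewrite inE.
rewrite (exchange_big_dep (mem edges)) /=; last by move=> v e _ /andP[].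
apply: eq_bigr => e eE; rewrite -(card_faces_edge eE) -sum1_card.
apply: eq_bigl => v; rewrite eE /=; apply/idP/idP.
  by rewrite !inE => /andP[/andP[_ ->] ->].
move=> vV; rewrite (minimal_face_edge_lt vV eE).
by move: vV; rewrite inE => /andP[].
Qed.

End RankTwo.

End LrbFaces.

Lemma set2_injective (T : finType) (A : {set T}) a b c : #|A| = 2%N ->
  a \in A -> b \in A -> c \in A -> b != a -> c != a -> b = c.
Proof.
move=> A2 aA bA cA ba ca; apply/eqP/negPn/negP => bc.
have : (#|[set a; b; c]%SET| <= #|A|)%N.
  apply: subset_leq_card; apply/fintype.subsetP => u.
  by rewrite !inE -orbA => /or3P[] /eqP->.
rewrite A2 finset.setUC cardsU1 cards2 !inE.
by rewrite (eq_sym a) ba (negPf ca) (eq_sym c) (negPf bc).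
Qed.

(** * Bounds on the number of middle elements *)

Section RankTwoCount.
Variables (R : realType) (K : fieldType) (B : finLrbType).
Variables (d : Order.disp_t) (P : finPOrderType d).
Hypothesis B_CW : CW_lrb B R.
Hypothesis kB_iso : iso_incidence_algebra K B P.
Variables x y : B.
Hypothesis xy : supp_le x y.
Hypothesis rank2 : complex_dim (order_complex
  (order_interval (Lambda B) (left_ideal x) (left_ideal y))) = 2%N.

Local Notation middle := (middle x y).
Local Notation edges := (edges x y).

Lemma card_middle_le2 : (#|middle| <= 2)%N.
Proof.
have [phi [[psi phiK psiK] phiM]] := kB_iso.
have [p xp] := supp_char_idem_exists phiM phiK psiK x.
have [q yq] := supp_char_idem_exists phiM phiK psiK y.
(* One edge per middle support keeps the number of equations at m instead of 2m: edges of the same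
   support kill the same elements. The default [y] is never reached for [Z] in [middle]. *)
pose rep (Z : {set B}) := odflt y [pick e in edges | left_ideal e == Z].
have repP Z : Z \in middle -> rep Z \in edges /\ left_ideal (rep Z) = Z.
  move=> Zm; have [z zE] := middle_rep Zm; rewrite /rep.
  case: pickP => [e /andP[eE /eqP]//|noe]; case: notF.
  have zm : left_ideal z \in middle by rewrite -zE.
  have := zm; rewrite middleP => /and4P[_ _ zy _].
  rewrite -(noe (y * z)%g) zE left_ideal_eq /supp_eq supp_mulr supp_le_mul zy.
  rewrite supp_le_refl !andbT inE mulgA lrb_idem eqxx /=.
  by rewrite (_ : left_ideal _ = left_ideal z) //; apply/eqP;
    rewrite left_ideal_eq /supp_eq supp_mulr supp_le_mul zy supp_le_refl.
pose M := [set rep Z | Z in middle]%SET.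
have Mm : (#|M| <= #|middle|)%N by exact: leq_imset_card.
have /leq_trans : (#|minimal_faces x y| <= #|M| + 2)%N.
  apply: (card_minimal_faces_le phiM phiK psiK xp yq) => [b yb b_neq xb|].
    have [bx|bx] := boolP (supp_le b x); [by left | right].
    have bm : left_ideal b \in middle.
      rewrite middleP xb bx -{1}yb supp_mull /=.
      by apply: contra b_neq => /eqP; rewrite yb => ->.
    exists (rep (left_ideal b)); first exact: imset_f.
    by have [_ /eqP] := repP _ bm; rewrite left_ideal_eq => /andP[].
  move=> _ /imsetP[Z /repP[zE _] ->] v0 v v' v0V vV v'V.
  have mulV u : u \in minimal_faces x y ->
      (rep Z * u)%g \in minimal_faces x (rep Z).
    rewrite inE => /andP[_ xu]; apply: minimal_face_mul => //.
    by move: zE; rewrite inE middleP => /and3P[].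
  exact: (set2_injective (card_faces_edge B_CW xy rank2 zE) (mulV _ v0V) (mulV _ vV)
    (mulV _ v'V)).
move/(_ (#|middle| + 2)%N); rewrite leq_add2r (card_vertices B_CW xy rank2) => /(_ Mm).
by rewrite muln2 -addnn leq_add2l.
Qed.

Lemma card_middle_neq1 : #|middle| <> 1%N.
Proof.
move=> m1; have [phi [[psi phiK psiK] phiM]] := kB_iso.
have [p xp] := supp_char_idem_exists phiM phiK psiK x.
have [q yq] := supp_char_idem_exists phiM phiK psiK y.
have [_ [z [zE _]]] := exists_flag B_CW xy rank2.
have [r zr] := supp_char_idem_exists phiM phiK psiK z.
have := zE; rewrite inE => /andP[/eqP yz zm].
have := zm; rewrite middleP => /and4P[xz zx zy yz'].
have two (A : {set B}) : #|A| = 2%N -> exists a b, [/\ a \in A, b \in A & a != b].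
  by move=> A2; apply/card_gt1P; rewrite A2.
(* Each of the two covers gives a comparison in [P]; transitivity then yields [p <= q]. *)
have pr : (p <= r)%O.
  have [v [w [vV wV vw]]] := two _ (card_faces_edge B_CW xy rank2 zE).
  exact: (cover_le phiM phiK psiK xp zr (lower_cover xy rank2 zE) vV wV vw).
have rq : (r <= q)%O.
  have [v [w [vV wV vw]]] := two _ (card_faces_middle B_CW xy rank2 zm).
  exact: (cover_le phiM phiK psiK zr yq (upper_cover xy rank2 zm) vV wV vw).
have [v vV] := minimal_faces_not_all_below phiM phiK psiK xp yq (le_trans pr rq)
  xy yz' (not_supp_le_yx rank2) yz (lower_cover xy rank2 zE).
suff: v \in minimal_faces x z by rewrite inE => /andP[/eqP->]; rewrite eqxx.
(* For m = 1 both [z] and [y] have exactly two vertices, and those of [z] are among those of [y]. *)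
suff -> : minimal_faces x z = minimal_faces x y by [].
apply/eqP; rewrite eqEcard (card_vertices B_CW xy rank2) m1.
rewrite (card_faces_edge B_CW xy rank2 zE) andbT.
by apply/fintype.subsetP => u uV; exact: minimal_face_edge_lt uV zE.
Qed.

End RankTwoCount.

Theorem theorem7p8 (R : realType) (K : fieldType) (B : finLrbType)
  (B_connected : connected_lrb B R) (B_CW : CW_lrb B R)
  (kB_incidence : exists (d : Order.disp_t) (P : finPOrderType d),
      iso_incidence_algebra K B P) :
  thin (Lambda B).
Proof.
have [d [P kB_iso]] := kB_incidence.
move=> _ _ /imsetP[x _ ->] /imsetP[y _ ->]; rewrite left_ideal_le => xy rank2.
(* The interval has m + 2 elements, and the bounds leave only m = 2. *)
rewrite (card_interval xy rank2).
have := card_middle_le2 B_CW kB_iso xy rank2.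
have := card_middle_neq1 B_CW kB_iso xy rank2.
have := middle_neq0 rank2.
by case: #|_| => [|[|[|]]].
Qed.
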